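(* Let $K\in\mathbb{R}^{m\times n}$ be given and consider the hybrid system $\mathcal{H}_{cl}$ and the set $\mathcal{A}$ described in the context. Suppose there exist $W\in\mathbb{S}^{n}_+$, $R_1\in\mathbb{S}^{n_1}_+,\dots,R_q\in\mathbb{S}^{n_q}_+$, $S\in\mathbb{D}^{m}_+$, real numbers $\sigma_1,\dots,\sigma_q>0$ and $\bar\mu>0$, and matrices $Z,J\in\mathbb{R}^{m\times n}$ such that $$\begin{bmatrix} W & 0 & Z_{(i)}^{\mathsf T}\\ \star & \bigoplus_{j=1}^q R_j & J_{(i)}^{\mathsf T}\\ \star&\star&\frac{\bar u_i^2}{\bar\mu}\end{bmatrix}\succeq 0\qquad \forall i\in\{1,\dots,m\},$$ and, for all $\tau\in\mathcal{T}$, $$\mathfrak{M}(\tau):=\begin{bmatrix}\operatorname{He}((A+BK)W) & -BK & BS-WK^{\mathsf T}-Z^{\mathsf T}\\ \star & \operatorname{He}(R(\tau)A)-\Sigma R(\tau) & K^{\mathsf T}-J^{\mathsf T}\\ \star&\star&-2S\end{bmatrix}\prec 0,$$ where $R(\tau):=\bigoplus_{j=1}^q e^{\sigma_j\tau_j}R_j$ and $\Sigma:=\bigoplus_{j=1}^q\sigma_j\mathbf{I}_{n_j}$. Then the set $\mathcal{A}$ is exponentially stable for $\mathcal{H}_{cl}$, and the set $$\mathcal{Q}_{\bar\mu}:=\{x=(\bar x,\tau)\in\mathcal{C}:\ \bar x^{\mathsf T}\widehat P(\tau)\bar x\le\bar\mu\},\qquad \widehat P(\tau):=W^{-1}\oplus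 R(\tau),$$ is included in the basin of attraction of $\mathcal{A}$. In particular, there exist $\lambda,\kappa>0$ such that every maximal solution $\phi$ of $\mathcal{H}_{cl}$ with $\phi(0,0)\in\mathcal{Q}_{\bar\mu}$ satisfies $|\phi(t,j)|_{\mathcal{A}}\le\kappa e^{-\lambda(t+j)}|\phi(0,0)|_{\mathcal{A}}$ for all $(t,j)\in\operatorname{dom}\phi$.
   Context: Notation: $\mathbb{S}^k_+$ is the set of $k\times k$ symmetric positive definite matrices; $\mathbb{D}^m_+$ the set of $m\times m$ diagonal positive definite matrices; $\operatorname{He}(M)=M+M^{\mathsf T}$; $\bigoplus$ denotes block-diagonal direct sum; $\star$ denotes symmetric blocks; $M_{(i)}$ is the $i$-th row of a matrix $M$; $\mathbf{1}_q$ is the all-ones vector in $\mathbb{R}^q$. Setting: fix integers $n,m\ge1$, $1\le q\le n$, and $n_1,\dots,n_q\ge1$ with $n_1+\dots+n_q=n$; let $\mathcal{N}=\{1,\dots,q\}$. Let $A\in\mathbb{R}^{n\times n}$, $B\in\mathbb{R}^{n\times m}$, $\bar u=(\bar u_1,\dots,\bar u_m)$ with $\bar u_i>0$, and for each $i\in\mathcal{N}$ positive reals $T_1^{(i)}\le T_2^{(i)}$. Define $\mathfrak{sat}_{\bar u}(v)=(\operatorname{sat}_1(v_1),\dots,\operatorname{sat}_m(v_m))$ with $\operatorname{sat}_i(s)=\min(|s|,\bar u_i)\operatorname{sign}(s)$, and the deadzone $\mathfrak{dz}_{\bar u}(y)=\mathfrak{sat}_{\bar u}(y)-y$. For $K\in\mathbb{R}^{m\times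 n}$ let $A_{cl}=\begin{bmatrix}A+BK&-BK\\0&A\end{bmatrix}$, $B_{cl}=\begin{bmatrix}B\\0\end{bmatrix}$, $K_{cl}=\begin{bmatrix}K&-K\end{bmatrix}$. The state is $x=(x_p,\tilde\eta,\tau)\in\mathbb{R}^n\times\mathbb{R}^n\times\mathbb{R}^q$, $\bar x=(x_p,\tilde\eta)$, with $\tilde\eta=(\tilde\eta^{(1)},\dots,\tilde\eta^{(q)})$, $\tilde\eta^{(i)}\in\mathbb{R}^{n_i}$. Let $\mathcal{T}=[0,T_2^{(1)}]\times\dots\times[0,T_2^{(q)}]$. The hybrid system $\mathcal{H}_{cl}$ is $\dot x=f(x)$ for $x\in\mathcal{C}$, $x^+\in G(x)$ for $x\in\mathcal{D}$, where $\mathcal{C}=\mathbb{R}^{2n}\times\mathcal{T}$, $f(x)=(A_{cl}\bar x+B_{cl}\mathfrak{dz}_{\bar u}(K_{cl}\bar x),-\mathbf{1}_q)$; $\mathcal{D}_i=\{\tau\in\mathcal{T}:\tau_i=0\}$, $\mathcal{D}=\mathbb{R}^{2n}\times\bigcup_{i\in\mathcal{N}}\mathcal{D}_i$; $h_i(\tilde\eta)$ is the vector obtained from $\tilde\eta$ by replacing the block $\tilde\eta^{(i)}$ by $0$ and keeping the other blocks; $\widehat{\mathcal{G}}_i(\tau)=\{\chi\in\mathbb{R}^q:\chi_i\in[T_1^{(i)},T_2^{(i)}],\ \chi_k=\tau_k\ \forall k\ne i\}$; and $G(x)=\bigcup_{i\in\mathcal{N}:\,\tau\in\mathcal{D}_i}\{x_p\}\times\{h_i(\tilde\eta)\}\times\widehat{\mathcal{G}}_i(\tau)$.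 Solutions are hybrid arcs in the sense of Goebel–Sanfelice–Teel (defined on hybrid time domains, flowing in $\mathcal{C}$ according to $f$ and jumping from $\mathcal{D}$ according to $G$); maximal means not extendable, complete means unbounded domain. Let $\mathcal{A}=\{0\}\times\mathcal{T}\subset\mathbb{R}^{2n}\times\mathbb{R}^q$ and $|x|_{\mathcal{A}}$ the Euclidean distance from $x$ to $\mathcal{A}$. $\mathcal{A}$ is exponentially stable if there exist $\kappa,\lambda,\mu>0$ such that every maximal solution $\phi$ with $|\phi(0,0)|_{\mathcal{A}}\le\mu$ is complete and satisfies $|\phi(t,j)|_{\mathcal{A}}\le\kappa e^{-\lambda(t+j)}|\phi(0,0)|_{\mathcal{A}}$ for all $(t,j)\in\operatorname{dom}\phi$. The basin of attraction of $\mathcal{A}$ is the set of points from which every maximal solution is complete and converges to $\mathcal{A}$. *)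

(* Defs.v *)
From mathcomp Require Import all_boot all_order all_algebra.
From mathcomp Require Import all_classical all_reals all_analysis.
Set Implicit Arguments. Unset Strict Implicit. Unset Printing Implicit Defensive.
Import Order.TTheory GRing.Theory Num.Theory.
Import numFieldNormedType.Exports.
Local Open Scope ring_scope.
Local Open Scope classical_set_scope.

Section MatrixDefs.
Variable R : realType.

Definition posdef (k : nat) (M : 'M[R]_k) : Prop :=
  M^T = M /\ forall v : 'cV[R]_k, v != 0 -> 0 < (v^T *m M *m v) 0 0.

Definition possemidef (k : nat) (M : 'M[R]_k) : Prop :=
  M^T = M /\ forall v : 'cV[R]_k, 0 <= (v^T *m M *m v) 0 0.

Definition negdef (k : nat) (M : 'M[R]_k) : Prop := posdef (- M).

Definition diagposdef (k : nat) (M : 'M[R]_k) : Prop :=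
  is_diag_mx M /\ posdef M.

Definition He (k : nat) (M : 'M[R]_k) : 'M[R]_k := M + M^T.
End MatrixDefs.

(* Generic hybrid systems (Goebel--Sanfelice--Teel)                     *)
Section Hybrid.
Variables (R : realType) (X : normedModType R).

Definition compact_htd (E : set (R * nat)) : Prop :=
  exists (J : nat) (t : nat -> R),
    [/\ t 0%N = 0,
        (forall j, (j <= J)%N -> t j <= t j.+1) &
        E = [set p | (p.2 <= J)%N /\ t p.2 <= p.1 <= t p.2.+1]].

Definition hybrid_time_domain (E : set (R * nat)) : Prop :=
  (forall p, E p -> 0 <= p.1) /\
  forall (T : R) (J : nat), E (T, J) ->
    compact_htd (E `&` [set p | p.1 <= T /\ (p.2 <= J)%N]).

Definition abs_cont_on (a b : R) (g : R -> X) : Prop :=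
  forall eps : R, 0 < eps -> exists2 delta : R, 0 < delta &
    forall (N : nat) (s t : nat -> R),
      (forall k, (k < N)%N -> a <= s k /\ s k <= t k /\ t k <= b) ->
      (forall k l, (k < N)%N -> (l < N)%N -> k != l ->
                   t k <= s l \/ t l <= s k) ->
      \sum_(k < N) (t k - s k) < delta ->
      \sum_(k < N) `|g (t k) - g (s k)| < eps.

Definition loc_abs_cont (I : set R) (g : R -> X) : Prop :=
  forall a b : R, a <= b -> `[a, b] `<=` I -> abs_cont_on a b g.

Variables (C : set X) (f : X -> X) (D : set X) (G : X -> set X).

(* phi, restricted to the domain E, is a solution of the hybrid system.
   (Values of phi outside E are irrelevant.) *)
Definition is_solution (E : set (R * nat)) (phi : R -> nat -> X) : Prop :=
  [/\ hybrid_time_domain E,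
      E (0, 0%N) /\ (closure C `|` D) (phi 0 0%N),
      (forall j : nat, loc_abs_cont [set t | E (t, j)] (fun t => phi t j)),
      (forall j : nat,
         (forall t, interior [set s | E (s, j)] t -> C (phi t j)) /\
         {ae (@lebesgue_measure R), forall t,
            interior [set s | E (s, j)] t ->
            is_derive t 1 (fun s => phi s j) (f (phi t j))}) &
      (forall (t : R) (j : nat), E (t, j) -> E (t, j.+1) ->
         D (phi t j) /\ G (phi t j) (phi t j.+1))].

Definition maximal_solution (E : set (R * nat)) (phi : R -> nat -> X) : Prop :=
  is_solution E phi /\
  ~ (exists (E' : set (R * nat)) (psi : R -> nat -> X),
       [/\ is_solution E' psi, E `<=` E', E <> E' &
           forall t j, E (t, j) -> psi t j = phi t j]).

Definition complete_dom (E : set (R * nat)) : Prop :=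
  forall M : R, exists t j, E (t, j) /\ M <= t + j%:R.

(* exponential stability of a set, with distance function dist to it *)
Definition exp_stable (dist : X -> R) : Prop :=
  exists (kappa lambda mu : R), [/\ 0 < kappa, 0 < lambda, 0 < mu &
    forall E phi, maximal_solution E phi -> dist (phi 0 0%N) <= mu ->
      complete_dom E /\
      forall t j, E (t, j) ->
        dist (phi t j) <= kappa * expR (- lambda * (t + j%:R)) * dist (phi 0 0%N)].

Definition in_basin (dist : X -> R) (x : X) : Prop :=
  forall E phi, maximal_solution E phi -> phi 0 0%N = x ->
    complete_dom E /\
    forall eps : R, 0 < eps -> exists M : R,
      forall t j, E (t, j) -> M <= t + j%:R -> dist (phi t j) <= eps.
End Hybrid.

(* State x = ((x_p, eta), tau) in R^n x R^n x R^q, n = \sum_i n_i      *)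
Section Closed_loop.
Variables (R : realType) (m q : nat) (ns : 'I_q -> nat).
Local Notation n := (\sum_(i < q) ns i)%N.
Local Notation state := ('cV[R]_n * 'cV[R]_n * 'cV[R]_q)%type.

Definition Tset (T2 : 'I_q -> R) (tau : 'cV[R]_q) : Prop :=
  forall i, 0 <= tau i 0 <= T2 i.

Definition satv (ubar : 'I_m -> R) (v : 'cV[R]_m) : 'cV[R]_m :=
  \col_i (Num.min `|v i 0| (ubar i) * Num.sg (v i 0)).
Definition dzv (ubar : 'I_m -> R) (v : 'cV[R]_m) : 'cV[R]_m := satv ubar v - v.

Definition Acl (A : 'M[R]_n) (B : 'M[R]_(n, m)) (K : 'M[R]_(m, n))
  : 'M[R]_(n + n) := block_mx (A + B *m K) (- (B *m K)) 0 A.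
Definition Bcl (B : 'M[R]_(n, m)) : 'M[R]_(n + n, m) := col_mx B 0.
Definition Kcl (K : 'M[R]_(m, n)) : 'M[R]_(m, n + n) := row_mx K (- K).

Definition xbar (x : state) : 'cV[R]_(n + n) := col_mx x.1.1 x.1.2.

Definition flow_cl (A : 'M[R]_n) (B : 'M[R]_(n, m)) (K : 'M[R]_(m, n))
  (ubar : 'I_m -> R) (x : state) : state :=
  let v := Acl A B K *m xbar x + Bcl B *m dzv ubar (Kcl K *m xbar x) in
  (usubmx v, dsubmx v, - const_mx 1).

Definition C_cl (T2 : 'I_q -> R) : set state := fun x => Tset T2 x.2.

Definition D_cl (T2 : 'I_q -> R) : set state :=
  fun x => Tset T2 x.2 /\ exists i : 'I_q, x.2 i 0 = 0.

Definition hblk (i : 'I_q) (eta : 'cV[R]_n) : 'cV[R]_n :=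
  (\mxdiag_(j < q) (if j == i then 0 else 1%:M : 'M[R]_(ns j))) *m eta.

Definition G_cl (T1 T2 : 'I_q -> R) (x : state) : set state :=
  fun y => exists i : 'I_q,
    [/\ Tset T2 x.2 /\ x.2 i 0 = 0,
        y.1.1 = x.1.1, y.1.2 = hblk i x.1.2,
        T1 i <= y.2 i 0 <= T2 i &
        forall k : 'I_q, k != i -> y.2 k 0 = x.2 k 0].

Definition eucl (x : state) : R :=
  Num.sqrt (\sum_i (x.1.1 i 0) ^+ 2 + \sum_i (x.1.2 i 0) ^+ 2
            + \sum_i (x.2 i 0) ^+ 2).

Definition A_set (T2 : 'I_q -> R) : set state :=
  fun x => x.1.1 = 0 /\ x.1.2 = 0 /\ Tset T2 x.2.

Definition distA (T2 : 'I_q -> R) (x : state) : R :=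
  inf [set eucl (x - y) | y in A_set T2].

Definition Rtau (sigma : 'I_q -> R) (Rb : forall j : 'I_q, 'M[R]_(ns j))
  (tau : 'cV[R]_q) : 'M[R]_n :=
  \mxdiag_(j < q) (expR (sigma j * tau j 0) *: Rb j).

Definition Sigma_mx (sigma : 'I_q -> R) : 'M[R]_n :=
  \mxdiag_(j < q) ((sigma j)%:M : 'M[R]_(ns j)).

Definition LMI1 (W : 'M[R]_n) (Rb : forall j : 'I_q, 'M[R]_(ns j))
  (Z J : 'M[R]_(m, n)) (ubar : 'I_m -> R) (mubar : R) (i : 'I_m)
  : 'M[R]_(n + n + 1) :=
  block_mx (block_mx W 0 0 (\mxdiag_(j < q) Rb j))
           (col_mx (row i Z)^T (row i J)^T)
           (row_mx (row i Z) (row i J))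
           ((ubar i ^+ 2 / mubar)%:M).

Definition Mfrak (A : 'M[R]_n) (B : 'M[R]_(n, m)) (K : 'M[R]_(m, n))
  (W : 'M[R]_n) (Rb : forall j : 'I_q, 'M[R]_(ns j)) (S : 'M[R]_m)
  (sigma : 'I_q -> R) (Z J : 'M[R]_(m, n)) (tau : 'cV[R]_q)
  : 'M[R]_(n + n + m) :=
  let N1 := B *m S - W *m K^T - Z^T in
  let N2 := K^T - J^T in
  block_mx (block_mx (He ((A + B *m K) *m W)) (- (B *m K))
                     (- (B *m K))^T
                     (He (Rtau sigma Rb tau *m A) - Sigma_mx sigma *m Rtau sigma Rb tau))
           (col_mx N1 N2)
           (row_mx N1^T N2^T)
           (- (2%:R *: S)).

Definition Phat (W : 'M[R]_n) (sigma : 'I_q -> R)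
  (Rb : forall j : 'I_q, 'M[R]_(ns j)) (tau : 'cV[R]_q) : 'M[R]_(n + n) :=
  block_mx (invmx W) 0 0 (Rtau sigma Rb tau).

Definition Qset (T2 : 'I_q -> R) (W : 'M[R]_n) (sigma : 'I_q -> R)
  (Rb : forall j : 'I_q, 'M[R]_(ns j)) (mubar : R) : set state :=
  fun x => C_cl T2 x /\
    ((xbar x)^T *m Phat W sigma Rb x.2 *m xbar x) 0 0 <= mubar.
End Closed_loop.

(* Main.v *)
(** The function V(x) = x_p^T W^-1 x_p + eta^T R(tau) eta is a Lyapunov function.
    On the sublevel set V <= mubar the first matrix inequality bounds the auxiliary
    feedback Z W^-1 x_p + J eta by ubar, so the deadzone satisfies a generalized
    sector condition there.  Together with the second matrix inequality, which holds
    uniformly because it is affine in the weights exp (sigma_j tau_j), this gives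
    V' <= - c V along the flow.  A jump only deletes a nonnegative term from V.
    Hence V <= exp (- c t) V(0).  The potential \sum_k tau_k / T1_k decreases at a
    constant rate along the flow and rises by at least 1 at each jump, so the number
    of jumps is at most affine in t and the decay is exponential in t + j.

    Solutions are only absolutely continuous and satisfy the differential equation
    almost everywhere; since the vector field is continuous they are in fact
    differentiable at every interior time.  A maximal solution with bounded domain
    could be extended: at the end of its last flow interval one adds the missing
    limit point, jumps if a timer vanishes, or flows on by Picard iteration. *)
Require Import Defs.
From mathcomp Require Import all_boot all_order all_algebra.
From mathcomp Require Import all_classical all_reals all_analysis.
From mathcomp Require Import ring lra.
Set Implicit Arguments. Unset Strict Implicit. Unset Printing Implicit Defensive.
Import Order.TTheory GRing.Theory Num.Theory.
Import numFieldNormedType.Exports.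
Local Open Scope ring_scope.
Local Open Scope classical_set_scope.

(** * Real line *)

Section RealLine.
Variable R : realType.
Implicit Types a b c t : R.

(** The decay estimate for V is known only where [V <= mubar], so no differential inequality can be
    integrated before the sublevel set is known to be invariant. Strict negativity of the derivative
    on the level [V = mubar] suffices for that, and this is the only place where the sign matters
    before integration. Decay in [t] alone says nothing about [j]: several timers can vanish
    together and jumps then follow one another without flow. The bound on the number of jumps
    therefore carries an offset; its slope in [t] lowers the rate [lambda], while the offset
    enlarges the overshoot [kappa]. The calculus is scalar. Vector curves are treated entry by entry
    and composed with a projection onto their time interval, so that every lemma can ask for
    continuity on the whole line. Limits are built without sequences: lower and upper bounds that
    are pairwise compatible have a common intermediate point, by completeness of the reals. *)

Lemma exists_between_families (I : Type) (i0 : I) (lo hi : I -> R) :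
  (forall i j, lo i <= hi j) -> exists l, forall i, lo i <= l <= hi i.
Proof.
move=> lohi; have hs : has_sup (range lo).
  split; first by exists (lo i0), i0.
  by exists (hi i0) => _ [i _ <-].
exists (sup (range lo)) => i; apply/andP; split.
  by apply: sup_upper_bound => //; exists i.
by apply: ge_sup; [exact: hs.1|move=> _ [j _ <-]].
Qed.

(** The supremum of the points up to which [P] holds throughout is reached by the last hypothesis
    and passed by the one before, unless it is [b]. This replaces compactness: the steps to the
    right may shrink without a uniform lower bound. *)
Lemma real_induction (P : R -> Prop) a b : a <= b -> P a ->
  (forall x, a <= x < b -> P x ->
     exists2 d, 0 < d & forall y, x < y -> y < x + d -> y <= b -> P y) ->
  (forall x, a < x <= b -> (forall y, a <= y < x -> P y) -> P x) ->
  forall x, a <= x <= b -> P x.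
Proof.
move=> ab Pa Pr Pl.
pose S := [set x | a <= x <= b /\ forall y, a <= y <= x -> P y].
have Sa : S a.
  split; first by rewrite lexx.
  by move=> y /andP[ay ya]; have -> : y = a by apply/eqP; rewrite eq_le ya ay.
have hS : has_sup S.
  by split; [exists a|exists b => x [/andP[]]].
pose s := sup S.
have as_ : a <= s by apply: sup_upper_bound.
have sb : s <= b by apply: ge_sup; [exists a|move=> x [/andP[]]].
have Plt y : a <= y < s -> P y.
  move=> /andP[ay ys].
  have [e Se ye] := sup_gt (hS.1) ys.
  by apply: Se.2; rewrite ay ltW.
have Ps : P s.
  have [as'|] := ltP a s; first by apply: Pl => //; rewrite as' sb.
  by move=> sa; have -> : s = a by apply/eqP; rewrite eq_le sa as_.
have Ple y : a <= y <= s -> P y.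
  move=> /andP[ay]; rewrite le_eqVlt => /orP[/eqP->//|ys].
  by apply: Plt; rewrite ay.
have [sb'|bs] := ltP s b; last first.
  move=> x /andP[ax xb]; apply: Ple; rewrite ax /=; exact: le_trans bs.
have /(Pr _)/(_ Ps) [d d0 Pd] : a <= s < b by rewrite as_.
pose z := Num.min b (s + d / 2).
have sz : s < z by rewrite lt_min sb' ltrDl divr_gt0.
have : S z.
  split; first by rewrite (le_trans as_ (ltW sz)) ge_min lexx.
  move=> y /andP[ay yz].
  have [ys|sy] := leP y s; first by apply: Ple; rewrite ay.
  apply: Pd => //; last by apply: le_trans yz _; rewrite ge_min lexx.
  apply: le_lt_trans yz _; rewrite gt_min; apply/orP; right.
  by lra.
by move/(sup_upper_bound hS); rewrite leNgt sz.
Qed.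

(** Multiplying out the difference quotient gives a form without division that also covers [s = t].
    Localisation, translation and passage to components become immediate. *)
Lemma is_deriveP (X : normedModType R) (g : R -> X) t (d : X) :
  is_derive t 1 g d <->
  forall e, 0 < e -> exists2 r, 0 < r &
    forall s, `|s - t| < r -> `|g s - g t - (s - t) *: d| <= e * `|s - t|.
Proof.
split=> [[dg dv] e e0|H].
  have : (fun h => h^-1 *: ((g \o shift t) (h *: 1) - g t)) @ 0^' --> d.
    by rewrite -dv; exact: dg.
  move/cvgrPdist_le => /(_ e e0)[/= r r0 rH].
  exists r => // s st.
  have [->|nst] := eqVneq s t.
    by rewrite !subrr scale0r subrr !normr0 mulr0.
  have st0 : s - t != 0 by rewrite subr_eq0.
  have := rH (s - t); rewrite /= sub0r normrN => /(_ st st0).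
  rewrite /shift /= scaler1 subrK -(ler_pM2r (_ : 0 < `|s - t|)) ?normr_gt0//.
  move=> /(le_trans _); apply; rewrite -normrN opprB [X in _ <= X]mulrC -normrZ.
  by rewrite scalerBr scalerA mulfV// scale1r -normrN opprB.
have cv : (fun h => h^-1 *: ((g \o shift t) (h *: 1) - g t)) @ 0^' --> d.
  apply/cvgrPdist_le => e e0; have [r r0 rH] := H e e0.
  exists r => //= h; rewrite /= sub0r normrN => hr h0.
  have := rH (h + t); rewrite addrK => /(_ hr).
  rewrite /shift /= scaler1 => /(le_trans _) Hh.
  rewrite -(ler_pM2l (_ : 0 < `|h|)) ?normr_gt0// -normrZ scalerBr scalerA.
  by rewrite mulfV// scale1r -normrN opprB [leRHS]mulrC; apply: Hh.
by split; [apply/cvg_ex; exists d|exact/cvg_lim].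
Qed.

Lemma is_derive_near (X : normedModType R) (f g : R -> X) t (d : X) r : 0 < r ->
  (forall s, `|s - t| < r -> f s = g s) -> is_derive t 1 f d -> is_derive t 1 g d.
Proof.
move=> r0 fg; apply: near_eq_is_derive; exists r => // s /= st.
by apply: fg; rewrite distrC.
Qed.

Lemma is_derive_oo_near (X : normedModType R) (f g : R -> X) t (d : X) a b :
  a < t < b -> (forall s, a < s < b -> f s = g s) ->
  is_derive t 1 f d -> is_derive t 1 g d.
Proof.
move=> /andP[at_ tb] fg; apply: (@is_derive_near _ _ _ _ _ (Num.min (t - a) (b - t))).
  by rewrite lt_min !subr_gt0 at_.
move=> s; rewrite lt_min !ltr_norml => /andP[/andP[h1 h2] /andP[h3 h4]].
by apply: fg; lra.
Qed.

Lemma continuousRP (X Y : normedModType R) (f : X -> Y) x :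
  {for x, continuous f} <->
  forall e, 0 < e -> exists2 r, 0 < r & forall y, `|x - y| < r -> `|f x - f y| <= e.
Proof.
split=> [fx e e0|H].
  have /cvgrPdist_le /(_ e e0) /nbhs_normP[r r0 rH] := fx.
  by exists r => // y xy; apply: rH.
apply/cvgrPdist_le => e /H[r r0 rH]; apply/nbhs_normP.
by exists r => // y; exact: rH.
Qed.

(** Projection onto [[a, b]] when [a <= b]. Composing with it extends a curve that is continuous on
    [[a, b]] to the whole line. It is also the scalar saturation, see [sat_clip]. *)
Definition clip a b t : R := Num.max a (Num.min b t).

Lemma clip_id a b t : a <= t <= b -> clip a b t = t.
Proof. by move=> /andP[h1 h2]; rewrite /clip min_r// max_r. Qed.

Lemma clip_itv a b t : a <= b -> a <= clip a b t <= b.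
Proof. by move=> ab; rewrite /clip le_max lexx ge_max ab ge_min lexx. Qed.

Lemma clip_dist a b t s : a <= b -> `|clip a b t - clip a b s| <= `|t - s|.
Proof.
move=> ab; rewrite /clip /Num.max /Num.min.
have h := ler_norm (t - s); have h' := ler_norm (s - t); rewrite distrC in h'.
rewrite ler_norml.
by do ! case: ifPn => //; rewrite -?leNgt => *; apply/andP; split; lra.
Qed.

Lemma clip_continuous a b : a <= b -> continuous (clip a b).
Proof.
move=> ab x; apply/continuousRP => e e0; exists e => // y xy.
exact: le_trans (clip_dist _ _ ab) (ltW xy).
Qed.

Lemma mean_value_le (f df : R -> R) a b c : a <= b ->
  (forall t, a < t < b -> is_derive t 1 f (df t)) -> continuous f ->
  (forall t, a < t < b -> df t <= c) -> f b - f a <= c * (b - a).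
Proof.
rewrite le_eqVlt => /orP[/eqP->|ab]; first by rewrite !subrr mulr0.
move=> fd fc dc.
have fd' x : x \in `]a, b[%R -> is_derive x 1 f (df x) by rewrite in_itv; exact: fd.
have [x] := MVT ab fd' (continuous_subspaceT fc).
by rewrite in_itv => /dc xc ->; rewrite ler_wpM2r// subr_ge0 ltW.
Qed.

Lemma mean_value_norm_le (f df : R -> R) a b c : a <= b ->
  (forall t, a < t < b -> is_derive t 1 f (df t)) -> continuous f ->
  (forall t, a < t < b -> `|df t| <= c) -> `|f b - f a| <= c * (b - a).
Proof.
move=> ab fd fc dc; rewrite ler_norml; apply/andP; split.
  have := @mean_value_le (fun t => - f t) (fun t => - df t) a b c ab.
  rewrite lerNl opprB opprK addrC; apply.
  - by move=> t /fd dt; exact: is_deriveN.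
  - by move=> x; apply: cvgN; exact: fc.
  - by move=> t /dc; rewrite ler_norml lerNl => /andP[].
by apply: (mean_value_le (df := df)) => // t /dc; apply: le_trans; exact: ler_norm.
Qed.

Lemma is_derive_continuous (X : normedModType R) (g : R -> X) t d :
  is_derive t 1 g d -> {for t, continuous g}.
Proof. by move=> [/derivable1_diffP/differentiable_continuous]. Qed.

Lemma lipschitz_continuous (X Y : normedModType R) (f : X -> Y) (L : R) : 0 < L ->
  (forall x y, `|f x - f y| <= L * `|x - y|) -> continuous f.
Proof.
move=> L0 fL x; apply/continuousRP => e e0; exists (e / L); first exact: divr_gt0.
by move=> y; rewrite ltr_pdivlMr// mulrC => /ltW; exact: le_trans (fL _ _).
Qed.

Lemma interiorRP (A : set R) t : interior A t <->
  exists2 r, 0 < r & forall s, `|t - s| < r -> A s.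
Proof. by split=> [/nbhs_ballP[r r0 rA]|[r r0 rA]]; [exists r|apply/nbhs_ballP; exists r]. Qed.

Lemma is_derive_translate (X : normedModType R) (g : R -> X) (t T : R) (d : X) :
  is_derive (t - T) 1 g d -> is_derive t 1 (fun s => g (s - T)) d.
Proof.
move=> /is_deriveP H; apply/is_deriveP => e /H[r r0 rH]; exists r => // s st.
have -> : s - t = (s - T) - (t - T) by ring.
by apply: rH; rewrite opprB addrA subrK.
Qed.

(** The sign of [l] is asked for only on the level [mu]. There, continuity keeps [l] negative for a
    short time and [v] cannot rise; strictly below the level, continuity of [v] leaves room; and the
    sublevel set is closed. Real induction combines the three facts. *)
Lemma invariant_sublevel (v l : R -> R) (a b mu : R) : a <= b ->
  continuous v -> continuous l -> (forall t, a < t < b -> is_derive t 1 v (l t)) ->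
  (forall t, a <= t <= b -> v t = mu -> l t < 0) -> v a <= mu ->
  forall t, a <= t <= b -> v t <= mu.
Proof.
move=> ab vc lc vd vl va; apply: real_induction => //.
- move=> x /andP[ax xb] vx.
  have [vmu|/eqP vmu] := eqVneq (v x) mu.
    have lx : l x < 0 by apply: vl => //; rewrite ax ltW.
    have l2 : 0 < - l x / 2 by rewrite divr_gt0// oppr_gt0.
    have /continuousRP/(_ _ l2)[r r0 rH] := lc x.
    exists r => // y xy yr yb.
    have := @mean_value_le v l x y 0 (ltW xy) _ vc.
    rewrite mul0r subr_le0 => H; apply: le_trans (H _ _) vx => t /andP[xt ty].
      by apply: vd; rewrite (le_lt_trans ax xt) (lt_le_trans ty yb).
    have /rH : `|x - t| < r by rewrite ltr_norml; apply/andP; split; lra.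
    by rewrite ler_norml => /andP[? ?]; lra.
  have vlt : 0 < mu - v x by rewrite subr_gt0 lt_neqAle vx andbT; apply/eqP.
  have /continuousRP/(_ _ vlt)[r r0 rH] := vc x.
  exists r => // y xy yr yb.
  have /rH : `|x - y| < r by rewrite ltr_norml; apply/andP; split; lra.
  by rewrite ler_norml => /andP[? ?]; lra.
- move=> x /andP[ax xb] H; rewrite leNgt; apply/negP => vx.
  have e0 : 0 < (v x - mu) / 2 by rewrite divr_gt0// subr_gt0.
  have /continuousRP/(_ _ e0)[r r0 rH] := vc x.
  pose y := Num.max a (x - r / 2).
  have ay : a <= y by rewrite le_max lexx.
  have yx : y < x by rewrite gt_max ax; lra.
  have yr : x - r / 2 <= y by rewrite le_max lexx orbT.
  have vy : v y <= mu by apply: H; rewrite ay.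
  have /rH : `|x - y| < r by rewrite ltr_norml; apply/andP; split; lra.
  by rewrite ler_norml => /andP[? ?]; lra.
Qed.

End RealLine.

(** * Absolutely continuous functions *)

Section AbsoluteContinuity.
Variable R : realType.
Notation mu := (@lebesgue_measure R).

Lemma ae_lebesgueS (P Q : R -> Prop) : (forall t, P t -> Q t) ->
  {ae mu, forall t, P t} -> {ae mu, forall t, Q t}.
Proof. by move=> PQ [N [mN N0 PN]]; exists N; split=> // t nQ; apply: PN => /PQ. Qed.

Lemma ae_lebesgueI (P Q : R -> Prop) : {ae mu, forall t, P t} -> {ae mu, forall t, Q t} ->
  {ae mu, forall t, P t /\ Q t}.
Proof.
move=> [N [mN N0 PN]] [M [mM M0 QM]]; exists (N `|` M); split.
- exact: measurableU.
- apply/eqP; rewrite eq_le measure_ge0 andbT.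
  apply: le_trans (measureU2 _ _ _) _ => //.
  by rewrite [X in (X + _)%E]N0 add0e [X in (X <= _)%E]M0.
- move=> t /= /not_andP[nP|nQ]; [left; exact: PN|right; exact: QM].
Qed.

Lemma ae_lebesgueW (P : R -> Prop) : (forall t, P t) ->
  {ae mu, forall t, P t}.
Proof. by move=> H; apply: aeW. Qed.

Lemma abs_cont_onW (X : normedModType R) (a b a' b' : R) (g : R -> X) :
  a <= a' -> b' <= b -> abs_cont_on a b g -> abs_cont_on a' b' g.
Proof.
move=> aa bb H e /H[d d0 dH]; exists d => // N s t st; apply: dH => k /st[h1 [h2 h3]].
by rewrite (le_trans aa h1) (le_trans h3 bb).
Qed.

Lemma abs_cont_on_eq (X : normedModType R) (a b : R) (g h : R -> X) :
  (forall t, a <= t <= b -> g t = h t) -> abs_cont_on a b g -> abs_cont_on a b h.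
Proof.
move=> gh H e /H[d d0 dH]; exists d => // N s t st dj sd.
have := dH N s t st dj sd.
rewrite (eq_bigr (fun k : 'I_N => `|h (t k) - h (s k)|))// => k _.
have [h1 [h2 h3]] := st k (ltn_ord k).
by rewrite !gh// ?h1 ?h3 ?(le_trans h1 h2)// (le_trans h2 h3).
Qed.

Lemma abs_cont_on_le (X Y : normedModType R) (a b : R) (g : R -> X) (h : R -> Y) :
  (forall s t, `|h t - h s| <= `|g t - g s|) -> abs_cont_on a b g -> abs_cont_on a b h.
Proof.
move=> gh H e /H[d d0 dH]; exists d => // N s t st dj sd.
by apply: le_lt_trans (dH N s t st dj sd); apply: ler_sum => k _; exact: gh.
Qed.

Lemma abs_cont_on_lipschitz (X : normedModType R) (a b L : R) (g : R -> X) :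
  (forall s t, a <= s -> s <= t -> t <= b -> `|g t - g s| <= L * (t - s)) ->
  abs_cont_on a b g.
Proof.
move=> gL e e0; have L0 : 0 < `|L| + 1 by rewrite ltr_wpDl.
exists (e / (`|L| + 1)); first exact: divr_gt0.
move=> N s t st _; rewrite ltr_pdivlMr// => /(le_lt_trans _); apply.
rewrite mulr_suml; apply: ler_sum => k _.
have [h1 [h2 h3]] := st k (ltn_ord k).
apply: le_trans (gL _ _ h1 h2 h3) _; rewrite mulrC.
by rewrite ler_wpM2l ?subr_ge0// (le_trans (ler_norm _))// lerDl.
Qed.

(** Each interval is replaced by its traces on the two sides of [c], taken with [min] and [max]; on
    the wrong side it degenerates to a point. Both traces stay admissible families, and the
    increments recombine by the triangle inequality through [g c]. *)
Lemma abs_cont_on_cat (X : normedModType R) (a b c : R) (g : R -> X) :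
  a <= c -> c <= b -> abs_cont_on a c g -> abs_cont_on c b g -> abs_cont_on a b g.
Proof.
move=> ac cb H1 H2 e e0; have e2 : 0 < e / 2 by rewrite divr_gt0.
have [d1 d10 h1] := H1 _ e2; have [d2 d20 h2] := H2 _ e2.
exists (Num.min d1 d2); first by rewrite lt_min d10.
move=> N s t st dj sd.
have minD (x y : R) : x <= y -> Num.min y c - Num.min x c <= y - x.
  by move=> ?; rewrite /Num.min; case: ifPn => ?; case: ifPn => ?; lra.
have maxD (x y : R) : x <= y -> Num.max y c - Num.max x c <= y - x.
  by move=> ?; rewrite /Num.max; case: ifPn => ?; case: ifPn => ?; lra.
have A : \sum_(k < N) `|g (Num.min (t k) c) - g (Num.min (s k) c)| < e / 2.
  apply: (h1 N (fun k => Num.min (s k) c) (fun k => Num.min (t k) c)).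
  - move=> k /st[p1 [p2 p3]]; rewrite le_min p1 ac; split=> //; split.
      exact: le_min2.
    by rewrite ge_min lexx orbT.
  - by move=> k l kN lN /(dj _ _ kN lN)[p|p]; [left|right]; exact: le_min2.
  - apply: (@le_lt_trans _ _ (\sum_(k < N) (t k - s k))).
      by apply: ler_sum => k _; apply: minD; have [_ []] := st k (ltn_ord k).
    by apply: lt_le_trans sd _; rewrite ge_min lexx.
have B : \sum_(k < N) `|g (Num.max (t k) c) - g (Num.max (s k) c)| < e / 2.
  apply: (h2 N (fun k => Num.max (s k) c) (fun k => Num.max (t k) c)).
  - move=> k /st[p1 [p2 p3]]; split; first by rewrite le_max lexx orbT.
    by split; [exact: le_max2|rewrite ge_max p3 cb].
  - by move=> k l kN lN /(dj _ _ kN lN)[p|p]; [left|right]; exact: le_max2.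
  - apply: (@le_lt_trans _ _ (\sum_(k < N) (t k - s k))).
      by apply: ler_sum => k _; apply: maxD; have [_ []] := st k (ltn_ord k).
    by apply: lt_le_trans sd _; rewrite ge_min lexx orbT.
rewrite (splitr e); apply: le_lt_trans (ltrD A B); rewrite -big_split /=.
apply: ler_sum => k _; have [_ [stk _]] := st k (ltn_ord k).
have [p|p] := leP (t k) c.
  have p' := le_trans stk p.
  by rewrite (max_r p')// (min_l p') subrr normr0 addr0.
have [p'|p'] := leP (s k) c.
  by rewrite -[_ - g (s k)](subrKA (g c)) addrC (le_trans (ler_normD _ _)).
by rewrite subrr normr0 add0r.
Qed.

Lemma abs_cont_on_continuous (X : normedModType R) (a b : R) (g : R -> X) :
  a <= b -> abs_cont_on a b g -> continuous (fun t => g (clip a b t)).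
Proof.
move=> ab H x; apply/continuousRP => e e0; have [d d0 dH] := H e e0.
exists d => // y xy.
have key s t : a <= s -> s <= t -> t <= b -> t - s < d -> `|g t - g s| <= e.
  move=> h1 h2 h3 h4; have := dH 1%N (fun=> s) (fun=> t).
  rewrite !big_ord1 => H1; apply/ltW; apply: H1 => // k l.
  by rewrite !ltnS !leqn0 => /eqP-> /eqP->.
have h := le_lt_trans (clip_dist x y ab) xy.
have /andP[p1 p2] := clip_itv x ab; have /andP[p3 p4] := clip_itv y ab.
have [le|le] := leP (clip a b x) (clip a b y).
  rewrite distrC; apply: key => //.
  by apply: le_lt_trans h; rewrite distrC ler_norm.
apply: key => //; first exact: ltW.
by apply: le_lt_trans h; rewrite ler_norm.
Qed.

(* Off the exceptional null set, [g] climbs with slope at most [c'] near each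
   point; the null set is covered by an open set [U] of small measure, on which
   absolute continuity controls the increments.  Real induction turns this into
   a finite chain of intervals joining [a] to [b]. *)
Lemma abs_cont_growth (g dg : R -> R) (a b c : R) : a <= b ->
  abs_cont_on a b g ->
  {ae mu, forall t, a < t < b -> is_derive t 1 g (dg t)} ->
  (forall t, a < t < b -> dg t <= c) ->
  g b - g a <= c * (b - a).
Proof.
move=> ab gAC [N [mN N0 HN]] dc.
(* The slack [c' - c] absorbs the error of the first-order expansion and [e] the increments over the
   null set. They are chosen below so that each costs at most half of the final error; the
   denominator [b - a + 1] also covers [a = b]. *)
suff key c' e : c < c' -> 0 < e -> g b - g a <= c' * (b - a) + e * (1 + `|c'|).
  apply/ler_addgt0Pr => e e0.
  have ba : 0 <= b - a by rewrite subr_ge0.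
  have h0 : 0 < e / (2 * (b - a + 1)) by rewrite divr_gt0// mulr_gt0//; lra.
  have h1 : 0 < e / 2 / (1 + `|c + e / (2 * (b - a + 1))|).
    by rewrite !divr_gt0// ltr_wpDr.
  have := key (c + e / (2 * (b - a + 1))) _ _ h1.
  rewrite ltrDl h0 => /(_ isT) /le_trans; apply.
  rewrite divfK; last by rewrite gt_eqF// ltr_wpDr.
  rewrite mulrDl -addrA lerD2l [leRHS](splitr e) lerD2r.
  have b1 : 0 < b - a + 1 by lra.
  have -> : e / (2 * (b - a + 1)) * (b - a) = e / 2 * ((b - a + 1)^-1 * (b - a)).
    by rewrite invfM !mulrA.
  rewrite ler_piMr ?divr_ge0 ?(ltW e0)//.
  by rewrite ler_pdivrMl// mulr1 lerDl.
move=> cc' e0.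
have [d d0 dH] := gAC e e0.
(* The endpoints join the exceptional set because the derivative is given only inside the
   interval. *)
pose N' := N `|` [set a; b].
have mN' : measurable N' by apply: measurableU => //; exact: measurableU.
have N'0 : mu N' = 0%E.
  apply/eqP; rewrite eq_le measure_ge0 andbT.
  apply: le_trans (measureU2 _ _ _) _ => //; first exact: measurableU.
  rewrite [X in (X + _)%E]N0 add0e; apply: le_trans (measureU2 _ _ _) _ => //.
  rewrite [X in (X + _)%E](_ : _ = 0%E); last exact: lebesgue_measure_set1.
  by rewrite add0e [X in (X <= _)%E](_ : _ = 0%E)//; exact: lebesgue_measure_set1.
have m0 : 0 < Num.min d e by rewrite lt_min d0.
have [|U [oU NU mU]] := @lebesgue_regularity_outer R N' _ mN' _ m0.
  by rewrite [X in (X < _)%E]N'0.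
have mmU : measurable U by exact: measurable_realfun.open_measurable.
have muU : (mu U < (Num.min d e)%:E)%E.
  apply: le_lt_trans mU; rewrite -[X in (_ <= X)%E]adde0 -N'0.
  apply: le_trans (measureU2 _ _ _) => //; last exact: measurableD.
  by apply: le_measure; rewrite ?inE//; [apply: measurableU => //; exact: measurableD|
    rewrite setUC; move=> x Ux; case: (pselect (N' x)); [left|right]].
(* Invariant of the real induction: up to [x], slope [c'] is exceeded only over finitely many
   intervals, whose total length is charged to [U]. The terms with [|c'|] pay for counting these
   intervals in [c' * (x - a)], which matters when [c'] is negative. *)
pose P x := exists (n : nat) (s t : nat -> R),
  [/\ forall k, (k < n)%N -> a <= s k /\ s k <= t k /\ t k <= x,
      forall k l, (k < n)%N -> (l < n)%N -> k != l -> t k <= s l \/ t l <= s k,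
      ((\sum_(k < n) (t k - s k))%:E <= mu (U `&` `[a, x]))%E &
      g x - g a <= c' * (x - a)
                   + \sum_(k < n) (`|g (t k) - g (s k)| + `|c'| * (t k - s k))].
(* The appended interval is measured as []x, y]], which lies in [U] and is disjoint from [[a, x]];
   thus the charge to [U] is additive. *)
have PU x y : a <= x -> x < y -> y <= b -> (forall z, x < z <= y -> U z) -> P x -> P y.
  move=> ax xy yb Uxy [n [s [t [h1 h2 h3 h4]]]].
  exists n.+1, (fun k => if k == n then x else s k), (fun k => if k == n then y else t k).
  split.
  - move=> k; rewrite ltnS leq_eqVlt; case: eqVneq => /= [_ _|_ /h1[p1 [p2 p3]]].
      by rewrite ax lexx (ltW xy).
    by rewrite p1 p2 (le_trans p3 (ltW xy)).
  - move=> k l; rewrite !ltnS (leq_eqVlt k) (leq_eqVlt l); case: (eqVneq k n) => [->|kn] /=.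
      case: (eqVneq l n) => [->|ln] /=; first by [].
      by move=> _ /h1[_ [_ p]] _; right.
    case: (eqVneq l n) => [->|ln] /=; first by move=> /h1[_ [_ p]] _ _; left.
    exact: h2.
  - rewrite big_ord_recr /= eqxx.
    rewrite (eq_bigr (fun k : 'I_n => t k - s k)); last first.
      by move=> k _; rewrite ltn_eqF.
    rewrite EFinD.
    have -> : ((y - x)%:E = mu `]x, y])%E.
      by rewrite lebesgue_measure_itv /= lte_fin xy -EFinB.
    apply: (le_trans (leeD2r _ h3)).
    rewrite -measureU//=; last 2 first.
    + exact: measurableI.
    + apply/seteqP; split=> z //= -[[_]]; rewrite !in_itv /= => /andP[_ p1] /andP[p2 _].
      by move: (le_lt_trans p1 p2); rewrite ltxx.
    apply: le_measure; rewrite ?inE.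
    + by apply: measurableU => //; exact: measurableI.
    + exact: measurableI.
    move=> z /= [[Uz]|]; rewrite !in_itv /= => /andP[p1 p2].
      by split=> //; rewrite p1 (le_trans p2)// ltW.
    by split; [apply: Uxy; rewrite p1 p2|rewrite p2 (le_trans ax)// ltW].
  - rewrite big_ord_recr /= eqxx.
    rewrite (eq_bigr (fun k : 'I_n => `|g (t k) - g (s k)| + `|c'| * (t k - s k))); last first.
      by move=> k _; rewrite ltn_eqF.
    have q1 := ler_norm (g y - g x).
    have q2 := ler_norm (- c'); rewrite normrN in q2.
    have q3 : 0 <= (`|c'| + c') * (y - x) by apply: mulr_ge0; lra.
    lra.
have PN x y : a <= x -> x < y -> y <= b -> g y - g x <= c' * (y - x) -> P x -> P y.
  move=> ax xy yb gxy [n [s [t [h1 h2 h3 h4]]]]; exists n, s, t; split=> //.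
  - by move=> k /h1[p1 [p2 p3]]; rewrite p1 p2 (le_trans p3 (ltW xy)).
  - apply: le_trans h3 _; apply: le_measure; rewrite ?inE; try exact: measurableI.
    by move=> z [Uz] /=; rewrite !in_itv /= => /andP[-> p]; rewrite (le_trans p) ?ltW.
  - lra.
(* The estimate holds for all intervals straddling [x], so it serves both to leave [x] to the right
   and to reach [x] from the left. *)
have drv x : a <= x <= b -> ~ N' x -> exists2 r, 0 < r &
    forall s t, s <= x -> x <= t -> x - r < s -> t < x + r -> g t - g s <= c' * (t - s).
  move=> /andP[ax xb] nN.
  have xab : a < x < b.
    rewrite !lt_neqAle ax xb !andbT; apply/andP; split; apply/eqP => xe; apply: nN.
      by right; left.
    by right; right.
  have dx : is_derive x 1 g (dg x).
    apply: contrapT => nd; apply: nN; left; apply: HN => h; exact/nd/h.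
  have cx := dc _ xab.
  have /is_deriveP /(_ (c' - c)) := dx; rewrite subr_gt0 => /(_ cc')[r r0 rH].
  exists r => // s t sx xt sr tr.
  have s1 : `|s - x| = x - s by rewrite distrC ger0_norm ?subr_ge0.
  have t1 : `|t - x| = t - x by rewrite ger0_norm ?subr_ge0.
  have s2 : x - s < r by lra.
  have t2 : t - x < r by lra.
  have := rH s; have := rH t; rewrite s1 t1 => /(_ t2) H1 /(_ s2) H2.
  move: H1 H2; rewrite !ler_norml /= => /andP[_ H1] /andP[H2 _].
  have E1 : (t - x) *: dg x = (t - x) * dg x by [].
  have E2 : (s - x) *: dg x = (s - x) * dg x by [].
  rewrite E1 in H1; rewrite E2 in H2.
  nra.
have Pb : P b.
  apply: (real_induction ab); last by rewrite ab lexx.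
  - exists 0%N, (fun=> 0), (fun=> 0); split=> //.
      by rewrite big_ord0 measure_ge0.
    by rewrite big_ord0 !subrr mulr0 addr0.
  - move=> x /andP[ax xb] Px; have [Nx|nNx] := pselect (N' x).
      have /nbhs_ballP[r /= r0 rU] : nbhs x U by apply: open_nbhs_nbhs; split=> //; exact: NU.
      exists r => // y xy yr yb; apply: (PU x) => // z /andP[xz zy].
      apply: rU; rewrite /ball /= ltr_distl.
      by apply/andP; split; lra.
    have [|r r0 rH] := drv x _ nNx; first by rewrite ax ltW.
    exists r => // y xy yr yb; apply: (PN x) => //; apply: rH => //; first exact: ltW.
    by lra.
  - move=> x /andP[ax xb] Plt; have [Nx|nNx] := pselect (N' x).
      have /nbhs_ballP[r /= r0 rU] : nbhs x U by apply: open_nbhs_nbhs; split=> //; exact: NU.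
      pose y := Num.max a (x - r / 2).
      have ay : a <= y by rewrite le_max lexx.
      have yx : y < x by rewrite gt_max ax; lra.
      apply: (PU y) => //; last by apply: Plt; rewrite ay.
      move=> z /andP[yz zx]; apply: rU; rewrite /ball /= ltr_distl.
      have yr : x - r / 2 <= y by rewrite le_max lexx orbT.
      by apply/andP; split; lra.
    have [|r r0 rH] := drv x _ nNx; first by rewrite ltW.
    pose y := Num.max a (x - r / 2).
    have ay : a <= y by rewrite le_max lexx.
    have yx : y < x by rewrite gt_max ax; lra.
    apply: (PN y) => //; last by apply: Plt; rewrite ay.
    have yr : x - r / 2 <= y by rewrite le_max lexx orbT.
    by apply: rH => //; [exact: ltW|lra|lra].
have [n [s [t [h1 h2 h3 h4]]]] := Pb.
apply: le_trans h4 _; rewrite lerD2l big_split /= -mulr_sumr mulrDr mulr1 [e * _]mulrC.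
have : \sum_(k < n) (t k - s k) < Num.min d e.
  rewrite -lte_fin; apply: le_lt_trans muU; apply: le_trans h3 _.
  by apply: le_measure; rewrite ?inE//; exact: measurableI.
rewrite lt_min => /andP[sd se].
apply: lerD; first exact/ltW/dH.
by apply: ler_wpM2l => //; exact: ltW.
Qed.

(** Near [t] almost every derivative is within [e] of [h t]. [abs_cont_growth], applied to [g] and
    to [- g], turns this into a two-sided bound on increments, which is the first-order expansion at
    [t]. *)
Lemma abs_cont_is_derive (g h : R -> R) (a b : R) : a <= b ->
  abs_cont_on a b g -> continuous h ->
  {ae mu, forall t, a < t < b -> is_derive t 1 g (h t)} ->
  forall t, a < t < b -> is_derive t 1 g (h t).
Proof.
move=> ab gAC hc gd t /andP[at_ tb]; apply/is_deriveP => e e0.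
have /continuousRP/(_ e e0)[r r0 rH] := hc t.
exists (Num.min r (Num.min (t - a) (b - t))).
  by rewrite !lt_min r0 !subr_gt0 at_.
move=> s; rewrite !lt_min => /andP[sr /andP[]].
rewrite !ltr_norml => /andP[p1 p2] /andP[p3 p4].
have main u v : u <= v -> a <= u -> v <= b -> (forall z, u < z < v -> `|t - z| < r) ->
    `|g v - g u - (v - u) * h t| <= e * (v - u).
  move=> uv au vb uvr.
  have uvd : {ae mu, forall z, u < z < v -> is_derive z 1 g (h z)}.
    apply: ae_lebesgueS gd => z zd /andP[uz zv]; apply: zd.
    by rewrite (le_lt_trans au uz) (lt_le_trans zv vb).
  have uvd' : {ae mu, forall z, u < z < v -> is_derive z 1 (fun w => - g w) (- h z)}.
    by apply: ae_lebesgueS uvd => z zd /zd ?; exact: is_deriveN.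
  have A := abs_cont_onW au vb gAC.
  have A' : abs_cont_on u v (fun w => - g w).
    by apply: abs_cont_on_le A => s' t'; rewrite -opprD normrN.
  have B z : u < z < v -> h z <= h t + e /\ - h z <= - h t + e.
    by move=> /uvr/rH; rewrite ler_norml => /andP[q1 q2]; split; lra.
  have := abs_cont_growth uv A uvd (fun z p => (B z p).1).
  have := abs_cont_growth uv A' uvd' (fun z p => (B z p).2).
  by rewrite ler_norml => q1 q2; apply/andP; split; lra.
have [st|ts] := leP s t.
  have := @main s t st; rewrite (ler0_norm (_ : s - t <= 0)) ?subr_le0//.
  rewrite opprB => H; have E : (s - t) *: h t = (s - t) * h t by [].
  rewrite E; have -> : g s - g t - (s - t) * h t = - (g t - g s - (t - s) * h t) by ring.
  rewrite normrN; apply: H; [lra|lra|] => z /andP[q1 q2].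
  by move: sr; rewrite !ltr_norml => /andP[? ?]; apply/andP; split; lra.
have E : `|s - t| = s - t by rewrite ger0_norm// subr_ge0 ltW.
rewrite E; apply: (main t s (ltW ts)); [lra|lra|] => z /andP[q1 q2].
by move: sr; rewrite !ltr_norml => /andP[? ?]; apply/andP; split; lra.
Qed.

End AbsoluteContinuity.

(** * Ordinary differential equations *)

Section MatrixNorm.
Variable R : realType.

Lemma entry_norm_le m n (M : 'M[R]_(m, n)) i j : `|M i j| <= `|M|.
Proof.
rewrite [leRHS]/Num.Def.normr /= mx_normrE.
by apply: (le_trans _ (le_bigmax _ _ (i, j))).
Qed.

Lemma mx_norm_le m n (M : 'M[R]_(m, n)) c : 0 <= c ->
  (forall i j, `|M i j| <= c) -> `|M| <= c.
Proof.
move=> c0 H; rewrite [leLHS]/Num.Def.normr /= mx_normrE.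
by apply: bigmax_le => // -[i j] _; exact: H.
Qed.

Lemma mulmx_norm_le m n p (M : 'M[R]_(m, n)) (N : 'M[R]_(n, p)) :
  `|M *m N| <= n%:R * `|M| * `|N|.
Proof.
apply: mx_norm_le; first by rewrite !mulr_ge0.
move=> i j; rewrite mxE; apply: le_trans (ler_norm_sum _ _ _) _.
have -> : n%:R * `|M| * `|N| = \sum_(k < n) (`|M| * `|N|).
  by rewrite sumr_const card_ord -mulrA mulr_natl.
by apply: ler_sum => k _; rewrite normrM ler_pM// entry_norm_le.
Qed.

Lemma continuous_mxP (T : topologicalType) m n (f : T -> 'M[R]_(m, n)) :
  (forall i j, continuous (fun t => f t i j)) <-> continuous f.
Proof.
split=> [H x|H i j x]; last first.
  apply: (@continuous_comp _ _ _ f (fun M : 'M[R]_(m, n) => M i j)); first exact: H.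
  exact: coord_continuous.
apply/cvgrPdist_le => e e0.
have : \forall y \near x, forall ij : 'I_m * 'I_n, `|f x ij.1 ij.2 - f y ij.1 ij.2| <= e.
  apply: filter_forall => -[i j] /=.
  by have /cvgrPdist_le := H i j x; exact.
apply: filterS => y Hy; apply: mx_norm_le; first exact: ltW.
by move=> i j; rewrite !mxE; exact: (Hy (i, j)).
Qed.
End MatrixNorm.

(** * Primitives frozen outside a bounded interval *)

Section Primitive.
Variables (R : realType) (h : R).
Hypothesis h0 : 0 < h.
Notation mu := (@lebesgue_measure R).

Let hh : - h <= h. Proof. by apply: le_trans (ltW h0); rewrite oppr_le0 ltW. Qed.

(** Integration starts at [- 2 h] and the value at [0] is subtracted, so that every clipped upper
    bound is interior to the domain of integration, on both sides of [0]. Clipping makes the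
    primitive of a continuous function Lipschitz on the whole line. *)
Definition primitive (g : R -> R) (t : R) : R :=
  Rintegral mu `[- (2 * h), clip (- h) h t] g - Rintegral mu `[- (2 * h), 0] g.

Lemma primitive0 g : primitive g 0 = 0.
Proof. by rewrite /primitive clip_id ?subrr// oppr_le0 ltW. Qed.

Lemma primitive_clip g t : primitive g (clip (- h) h t) = primitive g t.
Proof. by rewrite /primitive (@clip_id _ _ _ (clip _ _ _))// clip_itv. Qed.

Let is_derive_integral (g : R -> R) t : continuous g -> - (2 * h) < t < 2 * h ->
  is_derive t 1 (fun t => Rintegral mu `[- (2 * h), t] g) (g t).
Proof.
move=> gc /andP[t1 t2].
have ig : mu.-integrable `[- (2 * h), 2 * h] (EFin \o g).
  apply: continuous_compact_integrable; first exact: segment_compact.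
  exact: continuous_subspaceT.
have [dg dE] := continuous_FTC1_closed t2 ig t1 (gc t).
by split; [exact: dg|rewrite -derive1E].
Qed.

Lemma primitive_continuous g : continuous g -> continuous (primitive g).
Proof.
move=> gc t; apply: cvgB; last exact: cvg_cst.
apply: (@continuous_comp _ _ _ (clip (- h) h) (fun t => Rintegral mu `[- (2 * h), t] g)).
  exact: clip_continuous.
apply: is_derive_continuous (is_derive_integral gc _).
have /andP[? ?] := clip_itv t hh.
by apply/andP; split; move: h0; lra.
Qed.

Lemma is_derive_primitive g t : continuous g -> - h < t < h ->
  is_derive t 1 (primitive g) (g t).
Proof.
move=> gc tI; apply: (@is_derive_oo_near _ _
  (fun t => Rintegral mu `[- (2 * h), t] g - Rintegral mu `[- (2 * h), 0] g) _ _ _ _ _ tI).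
  by move=> s /andP[s1 s2]; rewrite /primitive clip_id// !ltW.
rewrite -[g t]subr0; have A : is_derive t 1 (fun t => Rintegral mu `[- (2 * h), t] g) (g t).
  by apply: is_derive_integral => //; move: tI h0 => /andP[? ?] ?; apply/andP; split; lra.
exact: (is_deriveB A (is_derive_cst _ _ _)).
Qed.

Lemma primitive_lipschitz g M s t : continuous g -> (forall t, `|g t| <= M) ->
  s <= t -> `|primitive g t - primitive g s| <= M * (t - s).
Proof.
move=> gc gM st; have M0 : 0 <= M := le_trans (normr_ge0 _) (gM 0).
have cst : clip (- h) h s <= clip (- h) h t by rewrite le_max2// le_min2.
rewrite -primitive_clip -(primitive_clip g s).
apply: (@le_trans _ _ (M * (clip (- h) h t - clip (- h) h s))).
  apply: (@mean_value_norm_le _ _ g) => //; last exact: primitive_continuous.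
  move=> u /andP[u1 u2]; apply: is_derive_primitive => //.
  have /andP[? ?] := clip_itv t hh; have /andP[? ?] := clip_itv s hh.
  by apply/andP; split; lra.
rewrite ler_wpM2l//; apply: le_trans (ler_norm _) _.
by apply: le_trans (clip_dist _ _ hh) _; rewrite ger0_norm// subr_ge0.
Qed.

Lemma primitive_dist f g M t : continuous f -> continuous g ->
  (forall t, `|f t - g t| <= M) -> `|primitive f t - primitive g t| <= M * h.
Proof.
move=> fc gc fg; have M0 : 0 <= M := le_trans (normr_ge0 _) (fg 0).
rewrite -primitive_clip -(primitive_clip g t).
have /andP[u1 u2] := clip_itv t hh; set u := clip _ _ _ in u1 u2 *.
pose F x := primitive f x - primitive g x.
have F0 : F 0 = 0 by rewrite /F !primitive0 subrr.
have Fc : continuous F by move=> x; apply: cvgB; exact: primitive_continuous.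
have Fd x : - h < x < h -> is_derive x 1 F (f x - g x).
  by move=> xh; apply: is_deriveB; exact: is_derive_primitive.
rewrite -[X in `|X|]/(F u) -[F u]subr0 -F0.
have [u0|u0] := leP 0 u.
  apply: (@le_trans _ _ (M * (u - 0))); last by rewrite subr0 ler_wpM2l.
  apply: (@mean_value_norm_le _ _ (fun x => f x - g x)) => // x /andP[? ?].
  by apply: Fd; apply/andP; split; move: h0; lra.
rewrite distrC; apply: (@le_trans _ _ (M * (0 - u))).
  apply: (@mean_value_norm_le _ _ (fun x => f x - g x)) => //; first exact: ltW.
  by move=> x /andP[? ?]; apply: Fd; apply/andP; split; move: h0; lra.
by rewrite ler_wpM2l// sub0r lerNl.
Qed.

End Primitive.

(** * Local existence for a globally Lipschitz vector field *)

Section Picard.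
Variables (R : realType) (k : nat) (F : 'cV[R]_k -> 'cV[R]_k) (L : R).
Hypothesis L0 : 0 < L.
Hypothesis FL : forall x y, `|F x - F y| <= L * `|x - y|.
Variable x0 : 'cV[R]_k.

(** With [L * h = 1 / 2] the integral operator halves uniform distances. *)
Let h : R := (2 * L)^-1.
Let h0 : 0 < h. Proof. by rewrite invr_gt0 mulr_gt0. Qed.
Let hL : L * h = 2^-1. Proof. by rewrite /h invfM mulrCA mulfV ?gt_eqF// mulr1. Qed.

(** The Picard integral operator. As [primitive] is constant outside [[- h, h]], all the distances
    below are uniform over the whole line and no time restriction has to be carried. *)
Let step (u : R -> 'cV[R]_k) (t : R) : 'cV[R]_k :=
  x0 + \col_i primitive h (fun s => F (u s) i 0) t.

Let Fc : continuous F. Proof. exact: lipschitz_continuous L0 FL. Qed.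

Let Fuc (u : R -> 'cV[R]_k) i : continuous u -> continuous (fun s => F (u s) i 0).
Proof.
move=> uc; have Fu : continuous (F \o u).
  by move=> x; apply: (@continuous_comp _ _ _ u F); [exact: uc|exact: Fc].
by move/continuous_mxP: Fu => /(_ i 0).
Qed.

Let step_continuous u : continuous u -> continuous (step u).
Proof.
move=> uc; apply/continuous_mxP => i j x.
rewrite (_ : (fun _ => _) = fun t => x0 i j + primitive h (fun s => F (u s) i 0) t).
  by apply: cvgD; [exact: cvg_cst|apply: primitive_continuous => //; exact: Fuc].
by apply/funext => t; rewrite /step !mxE.
Qed.

Let step_dist u v M : continuous u -> continuous v -> (forall t, `|u t - v t| <= M) ->
  forall t, `|step u t - step v t| <= M / 2.
Proof.
move=> uc vc uv t; have M0 : 0 <= M := le_trans (normr_ge0 _) (uv 0).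
apply: mx_norm_le; first exact: divr_ge0.
move=> i j; rewrite /step !mxE.
have -> : forall a b c : R, a + b - (a + c) = b - c by move=> a b c; ring.
rewrite -hL mulrCA mulrA; apply: primitive_dist => //; try exact: Fuc.
move=> s; apply: (@le_trans _ _ `|F (u s) - F (v s)|).
  by have := entry_norm_le (F (u s) - F (v s)) i 0; rewrite !mxE.
by apply: le_trans (FL _ _) _; rewrite ler_pM2l.
Qed.

Let iterate n := iter n step (fun=> x0).

Let iterate_continuous n : continuous (iterate n).
Proof. by elim: n => [|n IH] /=; [move=> x; exact: cvg_cst|exact: step_continuous]. Qed.

Let C0 : R := `|F x0| * h.
Let C0_ge0 : 0 <= C0. Proof. by apply: mulr_ge0 => //; exact: ltW. Qed.

Let iterateS n t : `|iterate n.+1 t - iterate n t| <= C0 / 2 ^+ n.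
Proof.
elim: n t => [|n IH] t.
  rewrite expr0 divr1 /=; apply: mx_norm_le => // i j; rewrite /step !mxE.
  rewrite addrAC subrr add0r -[X in `|X|]subr0 -(primitive0 h0 (fun s => F x0 i 0)).
  rewrite -(primitive_clip h0 _ t).
  have hh : - h <= h by apply: le_trans (ltW h0); rewrite oppr_le0 ltW.
  have /andP[u1 u2] := clip_itv t hh; set u := clip _ _ _ in u1 u2 *.
  have bd s s' : s <= s' -> s' - s <= h ->
    `|primitive h (fun _ => F x0 i 0) s' - primitive h (fun _ => F x0 i 0) s| <= C0.
    move=> ss sh; apply: le_trans (primitive_lipschitz (M := `|F x0|) h0 _ _ ss) _.
    + by move=> x; exact: cvg_cst.
    + by move=> _; exact: entry_norm_le.
    + by rewrite ler_wpM2l.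
  have [p|p] := leP 0 u; first by apply: bd => //; rewrite subr0.
  by rewrite distrC; apply: bd; [exact: ltW|rewrite sub0r lerNl].
have := step_dist (@iterate_continuous n.+1) (@iterate_continuous n) IH t.
by rewrite exprS invfM (mulrC 2^-1) mulrA.
Qed.

Let iterate_dist n p t : `|iterate (n + p) t - iterate n t| <= 2 * C0 / 2 ^+ n.
Proof.
(* The partial geometric sum [1 - 2^-p] is kept exactly, since the bound without it is not inductive
   in [p]. *)
suff : `|iterate (n + p) t - iterate n t| <= (2 * C0 / 2 ^+ n) * (1 - (2 ^+ p)^-1).
  move=> /le_trans; apply; apply: ler_piMr.
    by rewrite divr_ge0// ?exprn_ge0// mulr_ge0.
  by rewrite gerBl invr_ge0 exprn_ge0.
elim: p => [|p IH]; first by rewrite addn0 subrr normr0 expr0 invr1 subrr mulr0.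
rewrite addnS -(subrKA (iterate (n + p) t)).
apply: le_trans (ler_normD _ _) (le_trans (lerD (iterateS _ _) IH) _).
rewrite exprD exprS.
have a0 : (2 : R) ^+ n != 0 by rewrite expf_neq0.
have b0 : (2 : R) ^+ p != 0 by rewrite expf_neq0.
rewrite le_eqVlt; apply/orP; left; apply/eqP; field.
by rewrite a0 b0.
Qed.

(** Entry by entry, the intervals of radius [r n] around the iterates meet pairwise by
    [iterate_dist]; a common point is the limit, with its rate of convergence built in. *)
Let picard_limit : exists x : R -> 'cV[R]_k,
  forall n t, `|x t - iterate n t| <= 2 * C0 / 2 ^+ n.
Proof.
pose r n : R := 2 * C0 / 2 ^+ n.
have r0 n : 0 <= r n by rewrite divr_ge0// ?exprn_ge0// mulr_ge0.
have ent t i : exists l, forall n, iterate n t i 0 - r n <= l <= iterate n t i 0 + r n.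
  apply: (exists_between_families 0%N) => a b.
  have key c d : `|iterate (c + d) t i 0 - iterate c t i 0| <= r c.
    apply: le_trans (iterate_dist c d t).
    by have := entry_norm_le (iterate (c + d) t - iterate c t) i 0; rewrite !mxE.
  have [ab|ba] := leqP a b.
    have := key a (b - a)%N; rewrite subnKC// ler_norml => /andP[? ?].
    by have := r0 b; lra.
  have := key b (a - b)%N; rewrite subnKC ?(ltnW ba)// ler_norml => /andP[? ?].
  by have := r0 a; lra.
exists (fun t => \col_i sval (cid (ent t i))) => n t.
apply: mx_norm_le => [|i j]; first exact: r0.
rewrite !mxE; case: cid => /= l /(_ n).
by rewrite -/(r n) (ord1 j) ler_norml => /andP[? ?]; apply/andP; split; lra.
Qed.

Let half_pow (e : R) : 0 < e -> exists n, 2 * C0 / 2 ^+ n <= e.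
Proof.
move=> e0; pose n := Num.bound (2 * C0 / e); exists n.
have c0 : 0 <= 2 * C0 / e by apply: divr_ge0; [exact: mulr_ge0|exact: ltW].
rewrite ler_pdivrMr ?exprn_gt0// -ler_pdivrMl// mulrC.
apply: (@le_trans _ _ n%:R); first by apply/ltW; have := archi_boundP c0.
by rewrite -natrX ler_nat ltnW// ltn_expl.
Qed.

(** The Lipschitz bound, valid at all times because the solution is frozen outside [[- h, h]], is
    what later gives absolute continuity of the prolonged arc. The differential equation is claimed
    only on the open interval. *)
Theorem picard_lindelof : exists (d : R) (x : R -> 'cV[R]_k) (M : R),
  [/\ 0 < d, x 0 = x0,
      forall s t, s <= t -> `|x t - x s| <= M * (t - s) &
      forall t i, - d < t < d -> is_derive t 1 (fun s => x s i 0) (F (x t) i 0)].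
Proof.
have [x xH] := picard_limit.
have xc : continuous x.
  move=> t; apply/continuousRP => e e0; have e4 : 0 < e / 4 by rewrite divr_gt0.
  have [n ne] := half_pow e4.
  have /continuousRP/(_ _ e4)[r rp rH] := @iterate_continuous n t.
  exists r => // s ts.
  have -> : x t - x s = (x t - iterate n t) + (iterate n t - iterate n s) + (iterate n s - x s).
    by rewrite !addrA subrK subrK.
  apply: le_trans (ler_normD _ _) _; rewrite (distrC (iterate n s)).
  apply: le_trans (lerD (ler_normD _ _) (xH n s)) _.
  by have := xH n t; have := rH s ts; lra.
(* Both [x] and [step x] are close to the iterate of index [n.+1]: the first by the rate of
   convergence, the second by contraction from the iterate of index [n]. *)
have xfix t : x t = step x t.
  apply/eqP; rewrite -subr_eq0 -normr_eq0; apply/eqP/le_anti; rewrite normr_ge0 andbT.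
  apply/ler_addgt0Pr => e e0; rewrite add0r.
  have e2 : 0 < e / 2 by rewrite divr_gt0.
  have [n ne] := half_pow e2.
  have A := step_dist xc (@iterate_continuous n) (xH n) t.
  have B := xH n.+1 t.
  have C : 2 * C0 / 2 ^+ n.+1 = (2 * C0 / 2 ^+ n) / 2.
    by rewrite exprS invfM (mulrC 2^-1) mulrA.
  rewrite -(subrKA (iterate n.+1 t)) (le_trans (ler_normD _ _))//.
  rewrite (distrC _ (step x t)) /=; rewrite /= in A B.
  by rewrite C in B; lra.
(* The case [n = 0] of the rate of convergence confines [x] to distance [2 * C0] from [x0]. *)
have Fb s i : `|F (x s) i 0| <= `|F x0| + L * (2 * C0).
  apply: le_trans (entry_norm_le _ _ _) _.
  rewrite -[F (x s)](subrK (F x0)) addrC (le_trans (ler_normD _ _))// lerD2l.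
  apply: le_trans (FL _ _) _; rewrite ler_wpM2l ?(ltW L0)//.
  by have := xH 0%N s; rewrite expr0 divr1.
exists h, x, (`|F x0| + L * (2 * C0)); split=> //.
- by rewrite xfix; apply/matrixP => i j; rewrite /step !mxE primitive0// addr0 (ord1 j).
- move=> s t st; apply: mx_norm_le.
    by rewrite mulr_ge0 ?subr_ge0// addr_ge0// mulr_ge0 ?(ltW L0)// mulr_ge0.
  move=> i j; rewrite (xfix t) (xfix s) /step !mxE.
  have -> : forall a b c : R, a + b - (a + c) = b - c by move=> a b c; ring.
  by apply: primitive_lipschitz => //; exact: Fuc.
- move=> t i th.
  rewrite (_ : (fun s => x s i 0) = fun t => x0 i 0 + primitive h (fun s => F (x s) i 0) t).
    rewrite -[F (x t) i 0]add0r.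
    have A := @is_derive_primitive _ _ h0 (fun s => F (x s) i 0) t (@Fuc x i xc) th.
    exact: (is_deriveD (is_derive_cst _ _ _) A).
  by apply/funext => s; rewrite {1}xfix /step !mxE.
Qed.

End Picard.

(** * Quadratic forms *)

Section QuadraticForms.
Variable R : realType.

Definition dot k (u v : 'cV[R]_k) : R := (u^T *m v) 0 0.

Lemma dotE k (u v : 'cV[R]_k) : dot u v = \sum_i u i 0 * v i 0.
Proof. by rewrite /dot mxE; apply: eq_bigr => i _; rewrite mxE. Qed.

Lemma dotC k (u v : 'cV[R]_k) : dot u v = dot v u.
Proof. by rewrite !dotE; apply: eq_bigr => i _; rewrite mulrC. Qed.

Lemma dotDr k (u v w : 'cV[R]_k) : dot u (v + w) = dot u v + dot u w.
Proof. by rewrite /dot mulmxDr mxE. Qed.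

Lemma dotDl k (u v w : 'cV[R]_k) : dot (u + v) w = dot u w + dot v w.
Proof. by rewrite dotC dotDr !(dotC w). Qed.

Lemma dotNr k (u v : 'cV[R]_k) : dot u (- v) = - dot u v.
Proof. by rewrite /dot mulmxN mxE. Qed.

Lemma dotNl k (u v : 'cV[R]_k) : dot (- u) v = - dot u v.
Proof. by rewrite dotC dotNr dotC. Qed.

Lemma dotZr k a (u v : 'cV[R]_k) : dot u (a *: v) = a * dot u v.
Proof. by rewrite /dot -scalemxAr mxE. Qed.

Lemma dotZl k a (u v : 'cV[R]_k) : dot (a *: u) v = a * dot u v.
Proof. by rewrite dotC dotZr dotC. Qed.

Lemma dot0l k (u : 'cV[R]_k) : dot 0 u = 0.
Proof. by rewrite /dot trmx0 mul0mx mxE. Qed.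

Lemma dot_mulmx k l (M : 'M[R]_(k, l)) u v : dot u (M *m v) = dot (M^T *m u) v.
Proof. by rewrite /dot trmx_mul trmxK mulmxA. Qed.

Lemma dot_trmx k l (M : 'M[R]_(k, l)) u v : dot u (M^T *m v) = dot v (M *m u).
Proof. by rewrite dot_mulmx trmxK dotC. Qed.

Lemma dot_form k (M : 'M[R]_k) v : (v^T *m M *m v) 0 0 = dot v (M *m v).
Proof. by rewrite /dot mulmxA. Qed.

Lemma dot_col_mx k l (u u' : 'cV[R]_k) (v v' : 'cV[R]_l) :
  dot (col_mx u v) (col_mx u' v') = dot u u' + dot v v'.
Proof. by rewrite /dot tr_col_mx mul_row_col mxE. Qed.

Definition sqn k (v : 'cV[R]_k) : R := \sum_i (v i 0) ^+ 2.

Lemma sqnE k (v : 'cV[R]_k) : sqn v = dot v v.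
Proof. by rewrite dotE; apply: eq_bigr => i _; rewrite expr2. Qed.

Lemma sqn_ge0 k (v : 'cV[R]_k) : 0 <= sqn v.
Proof. by apply: sumr_ge0 => i _; exact: sqr_ge0. Qed.

Lemma entry_sqn k (v : 'cV[R]_k) i : (v i 0) ^+ 2 <= sqn v.
Proof. by rewrite /sqn (bigD1 i)//= lerDl; apply: sumr_ge0 => j _; exact: sqr_ge0. Qed.

Lemma sqn_col_mx k l (u : 'cV[R]_k) (v : 'cV[R]_l) : sqn (col_mx u v) = sqn u + sqn v.
Proof. by rewrite !sqnE dot_col_mx. Qed.

Lemma posdef_dot k (M : 'M[R]_k) v : posdef M -> v != 0 -> 0 < dot v (M *m v).
Proof. by move=> [_ H] /H; rewrite dot_form. Qed.

Lemma posdef_dot_ge0 k (M : 'M[R]_k) v : posdef M -> 0 <= dot v (M *m v).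
Proof.
move=> pM; have [->|/(posdef_dot pM)/ltW//] := eqVneq v 0.
by rewrite dot0l.
Qed.

Lemma posdef_unitmx k (M : 'M[R]_k) : posdef M -> M \in unitmx.
Proof.
move=> pM; rewrite unitmxE unitfE; apply/negP => /det0P[v v0 vM].
have /(posdef_dot pM) : v^T != 0 by rewrite -(inj_eq trmx_inj) trmxK trmx0.
by rewrite /dot trmxK mulmxA vM mul0mx mxE ltxx.
Qed.

Lemma posdef_invmx k (M : 'M[R]_k) : posdef M -> posdef (invmx M).
Proof.
move=> pM; have uM := posdef_unitmx pM; have [MT _] := pM.
split=> [|v v0]; first by rewrite trmx_inv MT.
rewrite dot_form -{1}(mulKVmx uM v) -{1}MT -dot_mulmx.
apply: posdef_dot => //; apply: contraNneq v0 => v0.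
by rewrite -(mulKVmx uM v) v0 mulmx0.
Qed.

Lemma posdef_cauchy_schwarz k (M : 'M[R]_k) u v : posdef M ->
  (dot u (M *m v)) ^+ 2 <= dot u (M *m u) * dot v (M *m v).
Proof.
move=> pM; have [MT _] := pM.
have [->|v0] := eqVneq v 0.
  by rewrite mulmx0 dot0l mulr0 dotC dot0l expr0n.
have q0 := posdef_dot pM v0.
have uv : dot v (M *m u) = dot u (M *m v) by rewrite dot_mulmx MT dotC.
(* This combination is the component of [u] that is [M]-orthogonal to [v], scaled to avoid a
   division. *)
have := posdef_dot_ge0 (dot v (M *m v) *: u - dot u (M *m v) *: v) pM.
rewrite mulmxBr -!scalemxAr dotDl !dotDr !dotNl !dotNr !dotZl !dotZr uv.
set a := dot u (M *m v); set b := dot v (M *m v); set c := dot u (M *m u).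
rewrite [X in 0 <= X](_ : _ = b * (c * b - a ^+ 2)); last by ring.
by rewrite pmulr_rge0// subr_ge0.
Qed.

(* Cauchy-Schwarz against [M^-1 e_i] bounds each coordinate: [v_i^2 <= (M^-1)_ii v^T M v]. *)
Lemma posdef_coercive k (M : 'M[R]_k) : posdef M ->
  exists2 c, 0 < c & forall v, c * sqn v <= dot v (M *m v).
Proof.
move=> pM; have uM := posdef_unitmx pM.
pose e i : 'cV[R]_k := invmx M *m delta_mx i 0.
pose t := 1 + \sum_i dot (e i) (M *m e i).
have t0 : 0 < t by rewrite ltr_pwDl// sumr_ge0// => i _; exact: posdef_dot_ge0.
exists t^-1 => [|v]; first by rewrite invr_gt0.
rewrite ler_pdivrMl// mulrDl mul1r mulr_suml.
apply: le_trans (_ : _ <= \sum_i dot (e i) (M *m e i) * dot v (M *m v)) _; last first.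
  by rewrite lerDr posdef_dot_ge0.
apply: ler_sum => i _; rewrite mulrC; apply: le_trans (posdef_cauchy_schwarz _ _ pM).
rewrite /e mulKVmx// dotE (bigD1 i)//= mxE !eqxx mulr1 big1 ?addr0//.
by move=> j ji; rewrite mxE (negbTE ji) mulr0.
Qed.

Lemma dot_upper k (M : 'M[R]_k) :
  exists2 c, 0 < c & forall v, dot v (M *m v) <= c * sqn v.
Proof.
exists (1 + \sum_i \sum_j `|M i j|) => [|v].
  by rewrite ltr_pwDl// sumr_ge0// => i _; rewrite sumr_ge0.
rewrite mulrDl mul1r mulr_suml (@le_trans _ _ (\sum_i (\sum_j `|M i j|) * sqn v))//; last first.
  by rewrite lerDr sqn_ge0.
rewrite dotE; apply: ler_sum => i _; rewrite mxE mulr_sumr mulr_suml.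
apply: ler_sum => j _.
have p1 := entry_sqn v i; have p2 := entry_sqn v j; have p3 := sqn_ge0 v.
have h : `|v i 0 * v j 0| <= sqn v.
  rewrite ler_norml; apply/andP; split.
    by have := sqr_ge0 (v i 0 + v j 0); nra.
  by have := sqr_ge0 (v i 0 - v j 0); nra.
rewrite mulrCA; apply: le_trans (ler_norm _) _.
by rewrite normrM ler_wpM2l.
Qed.

(** The inverse of [1 + \sum_i (c i)^-1] replaces the minimum, so that an empty index type needs no
    separate case. *)
Lemma exists_pos_lower_bound (I : finType) (c : I -> R) :
  (forall i, 0 < c i) -> exists2 c0, 0 < c0 & forall i, c0 <= c i.
Proof.
move=> cp.
have s0 i : 0 <= \sum_(j | j != i) (c j)^-1 by rewrite sumr_ge0// => j _; rewrite invr_ge0 ltW.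
have t0 : 0 < 1 + \sum_i (c i)^-1.
  by rewrite ltr_pwDl// sumr_ge0// => j _; rewrite invr_ge0 ltW.
exists (1 + \sum_i (c i)^-1)^-1 => [|i]; first by rewrite invr_gt0.
rewrite -[c i]invrK lef_pV2 ?posrE ?invr_gt0// (bigD1 i)//=.
by have := s0 i; lra.
Qed.

Section BlockDiagonal.
Variables (q : nat) (ns : 'I_q -> nat).
Implicit Types u v : 'cV[R]_(\sum_(i < q) ns i).

Lemma dot_submxcol u v : dot u v = \sum_j dot (submxcol u j) (submxcol v j).
Proof.
rewrite -{1}(submxcolK u) -{1}(submxcolK v) /dot tr_mxcol mul_mxrow_mxcol.
by rewrite summxE.
Qed.

Lemma sqn_submxcol v : sqn v = \sum_j sqn (submxcol v j).
Proof. by rewrite sqnE dot_submxcol; apply: eq_bigr => j _; rewrite sqnE. Qed.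

Lemma mxdiag_mulmx (B : forall j, 'M[R]_(ns j)) v :
  (\mxdiag_j B j) *m v = \mxcol_j (B j *m submxcol v j).
Proof. by rewrite -{1}(submxcolK v) mul_mxdiag_mxcol. Qed.

Lemma dot_mxdiag (B : forall j, 'M[R]_(ns j)) u v :
  dot u ((\mxdiag_j B j) *m v) = \sum_j dot (submxcol u j) (B j *m submxcol v j).
Proof. by rewrite mxdiag_mulmx dot_submxcol; apply: eq_bigr => j _; rewrite mxcolK. Qed.

End BlockDiagonal.

(** Without saturation the first factor is zero. Under saturation it has the sign opposite to [y],
    while the second factor cannot have that sign because [h] does not exceed the saturation
    level. *)
Lemma sat_sector (y u h : R) : 0 < u -> `|h| <= u ->
  (Num.min `|y| u * Num.sg y - y) * (Num.min `|y| u * Num.sg y + h) <= 0.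
Proof.
move=> u0; rewrite ler_norml => /andP[h1 h2].
have [y0|y0|->] := ltgtP y 0; last by rewrite sgr0 mulr0 subrr mul0r.
  rewrite (ltr0_sg y0) (ltr0_norm y0) /Num.min.
  by case: ifPn; rewrite -?leNgt => yu; nra.
rewrite (gtr0_sg y0) (gtr0_norm y0) /Num.min.
by case: ifPn; rewrite -?leNgt => yu; nra.
Qed.

End QuadraticForms.

(** * The Lyapunov function *)

Section Lyapunov.
Variables (R : realType) (m q : nat) (ns : 'I_q -> nat).
Local Notation n := (\sum_(i < q) ns i)%N.
Local Notation state := ('cV[R]_n * 'cV[R]_n * 'cV[R]_q)%type.
Variables (A : 'M[R]_n) (B : 'M[R]_(n, m)) (K : 'M[R]_(m, n))
  (ubar : 'I_m -> R) (T1 T2 : 'I_q -> R)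
  (W : 'M[R]_n) (Rb : forall j : 'I_q, 'M[R]_(ns j))
  (S : 'M[R]_m) (sigma : 'I_q -> R) (mubar : R) (Z J : 'M[R]_(m, n)).
Hypothesis ubar_gt0 : forall i, 0 < ubar i.
Hypothesis T1_gt0 : forall i, 0 < T1 i.
Hypothesis T12 : forall i, T1 i <= T2 i.
Hypothesis pW : posdef W.
Hypothesis pR : forall j, posdef (Rb j).
Hypothesis dS : diagposdef S.
Hypothesis sigma_gt0 : forall j, 0 < sigma j.
Hypothesis mubar_gt0 : 0 < mubar.
Hypothesis lmi1 : forall i : 'I_m, possemidef (LMI1 W Rb Z J ubar mubar i).
Hypothesis lmi2 : forall tau : 'cV[R]_q, Tset T2 tau ->
  negdef (Mfrak A B K W Rb S sigma Z J tau).

Let T2_gt0 i : 0 < T2 i. Proof. exact: lt_le_trans (T12 i). Qed.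

Let weight (tau : 'cV[R]_q) j : R := expR (sigma j * tau j 0).
Let blkform (j : 'I_q) (eta : 'cV[R]_n) : R :=
  dot (submxcol eta j) (Rb j *m submxcol eta j).

Let blkform_ge0 j eta : 0 <= blkform j eta. Proof. exact: posdef_dot_ge0. Qed.

Definition lyapunov (x : state) : R :=
  dot x.1.1 (invmx W *m x.1.1)
  + \sum_j expR (sigma j * x.2 j 0) * dot (submxcol x.1.2 j) (Rb j *m submxcol x.1.2 j).

Lemma dot_Rtau tau u v : dot u (Rtau sigma Rb tau *m v)
  = \sum_j expR (sigma j * tau j 0) * dot (submxcol u j) (Rb j *m submxcol v j).
Proof.
by rewrite dot_mxdiag; apply: eq_bigr => j _; rewrite -scalemxAl dotZr.
Qed.

Lemma lyapunovE x :
  ((xbar x)^T *m Phat W sigma Rb x.2 *m xbar x) 0 0 = lyapunov x.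
Proof.
rewrite dot_form /xbar /Phat mul_block_col !mul0mx add0r addr0 dot_col_mx.
by rewrite dot_Rtau.
Qed.

(** The derivative of [lyapunov] along the flow, as [is_derive_lyapunov] confirms. The terms in
    [sigma j] come from the timers, which decrease at unit rate. *)
Definition lyapunov_flow (x : state) : R :=
  2 * dot x.1.1 (invmx W *m (flow_cl A B K ubar x).1.1)
  + \sum_j (expR (sigma j * x.2 j 0) *
      (2 * dot (submxcol x.1.2 j) (Rb j *m submxcol (flow_cl A B K ubar x).1.2 j)
       - sigma j * dot (submxcol x.1.2 j) (Rb j *m submxcol x.1.2 j))).

Lemma flow_cl_plant x : (flow_cl A B K ubar x).1.1
  = (A + B *m K) *m x.1.1 - B *m K *m x.1.2 + B *m dzv ubar (K *m x.1.1 - K *m x.1.2).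
Proof.
rewrite /flow_cl /= /Acl /Bcl /Kcl /xbar mul_block_col mul_row_col mul_col_mx mul0mx.
by rewrite add_col_mx col_mxKu !mulNmx.
Qed.

Lemma flow_cl_error x : (flow_cl A B K ubar x).1.2 = A *m x.1.2.
Proof.
rewrite /flow_cl /= /Acl /Bcl /Kcl /xbar mul_block_col mul_col_mx !mul0mx.
by rewrite add_col_mx col_mxKd add0r addr0.
Qed.

(** Together with [Mblk], this splits the quadratic form of [Mfrak] into a part free of the timers
    and the coefficients of the weights, which makes its affine dependence on the weights
    explicit. *)
Let Mconst xi eta (w : 'cV[R]_m) : R :=
  2 * dot xi ((A + B *m K) *m W *m xi) - 2 * dot xi (B *m K *m eta)
  + 2 * dot xi ((B *m S - W *m K^T - Z^T) *m w) + 2 * dot eta ((K^T - J^T) *m w)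
  - 2 * dot w (S *m w).

Let Mblk (j : 'I_q) (eta : 'cV[R]_n) : R :=
  2 * dot (submxcol eta j) (Rb j *m submxcol (A *m eta) j) - sigma j * blkform j eta.

Let dot_He k (M : 'M[R]_k) v : dot v (He M *m v) = 2 * dot v (M *m v).
Proof.
rewrite /He mulmxDl dotDr (dot_mulmx M^T) trmxK (dotC (M *m v)); ring.
Qed.

Lemma Mfrak_form tau xi eta w (z := col_mx (col_mx xi eta) w) :
  dot z (Mfrak A B K W Rb S sigma Z J tau *m z)
  = Mconst xi eta w + \sum_j weight tau j * Mblk j eta.
Proof.
rewrite /z /Mfrak !mul_block_col !dot_col_mx.
rewrite !mul_col_mx !mul_row_col !add_col_mx !dot_col_mx.
rewrite !(dotDr xi) !(dotDr eta) !(dotDr w).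
rewrite !dot_trmx dot_He [in X in dot eta X]mulmxBl dotDr dot_He dotNr.
rewrite !mulNmx !dotNr -scalemxAl dotZr.
have -> : dot eta (Rtau sigma Rb tau *m A *m eta)
    = \sum_j weight tau j * dot (submxcol eta j) (Rb j *m submxcol (A *m eta) j).
  by rewrite -mulmxA dot_Rtau.
have -> : dot eta (Sigma_mx ns sigma *m Rtau sigma Rb tau *m eta)
    = \sum_j weight tau j * (sigma j * blkform j eta).
  rewrite -mulmxA dot_mxdiag; apply: eq_bigr => j _.
  rewrite mul_scalar_mx dotZr mxdiag_mulmx mxcolK -scalemxAl dotZr /weight /blkform; ring.
rewrite /Mconst /Mblk.
rewrite [X in _ = _ + X](_ : _ =
    2 * (\sum_j weight tau j * dot (submxcol eta j) (Rb j *m submxcol (A *m eta) j))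
    - \sum_j weight tau j * (sigma j * blkform j eta)); first by ring.
by rewrite mulr_sumr -sumrB; apply: eq_bigr => j _; ring.
Qed.

Let vertex (X : {set 'I_q}) : 'cV[R]_q := \col_j (if j \in X then T2 j else 0).

(* [Mfrak] is affine in the weights [exp (sigma_j tau_j)], which range over a
   box, so for each vector the worst timer value is a vertex of [0, T2]. *)
Lemma Mfrak_uniform : exists2 c, 0 < c & forall tau xi eta w, Tset T2 tau ->
  Mconst xi eta w + \sum_j weight tau j * Mblk j eta <= - (c * (sqn xi + sqn eta)).
Proof.
have vT X : Tset T2 (vertex X).
  by move=> j; rewrite mxE; case: ifP => _; rewrite lexx ?ltW.
have /choice[c cP] : forall X, exists c, 0 < c /\ forall xi eta w,
    Mconst xi eta w + \sum_j weight (vertex X) j * Mblk j eta <= - (c * (sqn xi + sqn eta)).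
  move=> X; have [c c0 cH] := posdef_coercive (lmi2 (vT X)).
  exists c; split=> // xi eta w; have := cH (col_mx (col_mx xi eta) w).
  rewrite mulNmx dotNr Mfrak_form !sqn_col_mx lerNr => /le_trans; apply.
  by rewrite lerN2 ler_pM2l// lerDl sqn_ge0.
(* There are finitely many vertices, so their coercivity constants have a common positive lower
   bound. *)
have [c0 c00 c0P] := exists_pos_lower_bound (fun X => (cP X).1).
exists c0 => // tau xi eta w tauT.
pose X := [set j | 0 < Mblk j eta]%SET.
apply: le_trans (_ : _ <= Mconst xi eta w + \sum_j weight (vertex X) j * Mblk j eta) _.
  rewrite lerD2l; apply: ler_sum => j _.
  have /andP[t0 tT] := tauT j.
  rewrite /weight mxE inE; case: ltP => Mj.
    by rewrite ler_pM2r// ler_expR ler_pM2l.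
  by rewrite ler_wnM2r// mulr0 expR0 -[leLHS]expR0 ler_expR mulr_ge0// ltW.
apply: le_trans ((cP X).2 _ _ _) _; rewrite lerN2 ler_wpM2r// addr_ge0 ?sqn_ge0//.
Qed.

Let Wsym : W^T = W. Proof. by case: pW. Qed.
Let uW : W \in unitmx. Proof. exact: posdef_unitmx. Qed.

Lemma weight_ge1 tau j : Tset T2 tau -> 1 <= weight tau j.
Proof.
by move=> /(_ j)/andP[t0 _]; rewrite -expR0 ler_expR mulr_ge0// ltW.
Qed.

(** A Schur complement by hand: tested on [xi], [eta] and a scalar [a], the first matrix inequality
    is a nonnegative quadratic polynomial in [a], with constant term [p] and half linear coefficient
    [hi]. The weights are at least 1 on the timer set, hence [p <= lyapunov x <= mubar]. *)
Lemma auxiliary_feedback_bound x i : Tset T2 x.2 -> lyapunov x <= mubar ->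
  `|(Z *m (invmx W *m x.1.1) + J *m x.1.2) i 0| <= ubar i.
Proof.
move=> xT xmu; set xi := invmx W *m x.1.1; set eta := x.1.2.
set hi := (X in `|X|).
pose p := dot xi (W *m xi) + \sum_j blkform j eta.
have pmu : p <= mubar.
  apply: le_trans xmu; rewrite /p /lyapunov /xi mulKVmx// (dotC x.1.1) lerD2l.
  apply: ler_sum => j _; apply: ler_peMl; [exact: blkform_ge0|exact: weight_ge1].
have form a : 0 <= p + 2 * a * hi + a ^+ 2 * (ubar i ^+ 2 / mubar).
  have [_ /(_ (col_mx (col_mx xi eta) (const_mx a)))] := lmi1 i.
  rewrite dot_form /LMI1 !mul_block_col !mul0mx addr0 add0r.
  rewrite !mul_col_mx mul_row_col !add_col_mx !dot_col_mx !dotDr.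
  rewrite dot_mxdiag mul_scalar_mx dotZr.
  have rowE (M : 'M[R]_(m, n)) v : dot v ((row i M)^T *m const_mx a) = a * (M *m v) i 0.
    rewrite dot_mulmx trmxK -row_mul /dot mxE big_ord1 !mxE mulrC.
    by congr (_ * _).
  have rowE' (M : 'M[R]_(m, n)) v : dot (const_mx a) (row i M *m v) = a * (M *m v) i 0.
    by rewrite -row_mul /dot mxE big_ord1 !mxE.
  have cc : dot (const_mx a : 'cV[R]_1) (const_mx a) = a * a by rewrite dotE big_ord1 !mxE.
  rewrite !rowE !rowE' cc => H.
  apply: le_trans H _; rewrite le_eqVlt; apply/orP; left; apply/eqP.
  have -> : hi = (Z *m xi) i 0 + (J *m eta) i 0 by rewrite /hi mxE.
  rewrite /p /blkform; ring.
have u2 : 0 < ubar i ^+ 2 by rewrite exprn_gt0.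
(* The minimiser of this polynomial. *)
have := form (- (hi * mubar / ubar i ^+ 2)).
have -> : p + 2 * - (hi * mubar / ubar i ^+ 2) * hi +
    (- (hi * mubar / ubar i ^+ 2)) ^+ 2 * (ubar i ^+ 2 / mubar)
  = p - hi ^+ 2 * mubar / ubar i ^+ 2.
  by field; rewrite !gt_eqF.
rewrite subr_ge0 ler_pdivrMr// => H.
have : hi ^+ 2 <= ubar i ^+ 2.
  rewrite -(ler_pM2r mubar_gt0); apply: le_trans H _.
  by rewrite mulrC ler_wpM2l// ltW.
by rewrite -[hi ^+ 2]real_normK ?num_real// ler_sqr// nnegrE ltW.
Qed.

(** As [S] is diagonal with positive entries, the product is a positively weighted sum of the scalar
    products bounded by [sat_sector]. *)
Lemma sector_condition (y h : 'cV[R]_m) (dz := dzv ubar y) : (forall i, `|h i 0| <= ubar i) ->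
  dot (invmx S *m dz) (y + h + dz) <= 0.
Proof.
move=> hb; have [/is_diag_mxP Sd pS] := dS; have uS := posdef_unitmx pS.
set w := invmx S *m dz.
have dzE i : dz i 0 = S i i * w i 0.
  rewrite -[dz](mulKVmx uS) mxE (bigD1 i)//= big1 ?addr0// => j ji.
  by rewrite Sd ?mul0r// eq_sym.
have Sii i : 0 < S i i.
  have /(posdef_dot pS) : (delta_mx i 0 : 'cV[R]_m) != 0.
    apply/eqP => /matrixP/(_ i 0); rewrite !mxE !eqxx => /eqP; rewrite oner_eq0//.
  rewrite -colE dotE (bigD1 i)//= big1 => [|j ji]; last by rewrite mxE (negbTE ji) mul0r.
  by rewrite !mxE !eqxx mul1r addr0.
rewrite dotE; apply: sumr_le0 => i _.
rewrite -(pmulr_rle0 _ (Sii i)) mulrA -dzE !mxE.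
set s := _ * Num.sg _.
have -> : y i 0 + h i 0 + (s - y i 0) = s + h i 0 by ring.
exact: sat_sector.
Qed.

Lemma lyapunov_le_sqn : exists2 c, 0 < c & forall x, Tset T2 x.2 ->
  lyapunov x <= c * (sqn x.1.1 + sqn x.1.2).
Proof.
have [c1 c10 H1] := dot_upper (invmx W).
have /choice[c2 H2] : forall j, exists c, 0 < c /\
    forall v, dot v (Rb j *m v) <= c * sqn v.
  by move=> j; have [c ? ?] := dot_upper (Rb j); exists c.
pose C j := expR (sigma j * T2 j) * c2 j.
have Cge0 j : 0 <= C j by rewrite mulr_ge0 ?expR_ge0// ltW//; case: (H2 j).
exists (c1 + \sum_j C j); first by rewrite ltr_pwDl// sumr_ge0.
move=> x xT; rewrite mulrDr; apply: lerD.
  apply: le_trans (H1 _) _; rewrite ler_wpM2r ?sqn_ge0// lerDl sumr_ge0//.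
apply: le_trans (_ : _ <= \sum_j C j * sqn x.1.2) _; last first.
  by rewrite -mulr_suml ler_wpM2r ?sqn_ge0// lerDr ltW.
apply: ler_sum => j _; rewrite -mulrA; have [c20 c2H] := H2 j.
have /andP[t0 tT] := xT j.
apply: ler_pM; rewrite ?expR_ge0 ?blkform_ge0//.
  by rewrite ler_expR ler_pM2l.
apply: le_trans (c2H _) _; rewrite ler_pM2l// sqn_submxcol [leRHS](bigD1 j)//= lerDl.
by rewrite sumr_ge0// => i _; exact: sqn_ge0.
Qed.

Lemma sqn_le_lyapunov : exists2 c, 0 < c & forall x, Tset T2 x.2 ->
  c * (sqn x.1.1 + sqn x.1.2) <= lyapunov x.
Proof.
have [c1 c10 H1] := posdef_coercive (posdef_invmx pW).
have /choice[c2 H2] : forall j, exists c, 0 < c /\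
    forall v, c * sqn v <= dot v (Rb j *m v).
  by move=> j; have [c ? ?] := posdef_coercive (pR j); exists c.
have [c3 c30 H3] := exists_pos_lower_bound (fun j => (H2 j).1).
exists (Num.min c1 c3); first by rewrite lt_min c10.
move=> x xT; rewrite mulrDr; apply: lerD.
  apply: le_trans (H1 _); rewrite ler_wpM2r ?sqn_ge0// ge_min lexx//.
rewrite sqn_submxcol mulr_sumr; apply: ler_sum => j _.
apply: le_trans (_ : _ <= blkform j x.1.2) _; last first.
  by apply: ler_peMl; [exact: blkform_ge0|exact: weight_ge1].
apply: le_trans ((H2 j).2 _); rewrite ler_wpM2r ?sqn_ge0//.
by rewrite (le_trans _ (H3 j))// ge_min lexx orbT.
Qed.

(** In the variables [xi = W^-1 x_p] and [w = S^-1 dz], the quadratic form of [Mfrak] equals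
    [lyapunov_flow x] minus twice the product of [sector_condition]. That product is nonpositive, so
    the form dominates the derivative. *)
Lemma lyapunov_decrease : exists2 c, 0 < c & forall x, Tset T2 x.2 ->
  lyapunov x <= mubar -> lyapunov_flow x <= - (c * lyapunov x).
Proof.
have [c1 c10 H1] := Mfrak_uniform; have [c2 c20 H2] := lyapunov_le_sqn.
have [c3 c30 H3] := dot_upper W.
exists (c1 / (c2 + c3)); first by rewrite divr_gt0// addr_gt0.
move=> x xT xmu.
set xi := invmx W *m x.1.1; set eta := x.1.2.
have xpE : x.1.1 = W *m xi by rewrite /xi mulKVmx.
set y := K *m x.1.1 - K *m eta.
set dz := dzv ubar y; set w := invmx S *m dz.
have dzE : dz = S *m w.
  by rewrite /w mulKVmx//; case: dS => _; exact: posdef_unitmx.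
have sec : dot w (y + (Z *m xi + J *m eta) + dz) <= 0.
  by apply: sector_condition => i; exact: auxiliary_feedback_bound.
(* [Mfrak_uniform] controls [xi], not the plant state, so [lyapunov] is bounded again in terms of
   [xi]; [c2] is applied to the error part alone. *)
have Vle : lyapunov x <= (c2 + c3) * (sqn xi + sqn eta).
  have E : lyapunov x = dot xi (W *m xi) + lyapunov (0, eta, x.2).
    rewrite /lyapunov /= mulmx0 dot0l add0r; congr (_ + _).
    by rewrite -/xi dotC -xpE.
  have e0 : sqn (0 : 'cV[R]_n) = 0 by rewrite sqnE dot0l.
  have := H2 (0, eta, x.2) xT; have := H3 xi; rewrite E /= e0 add0r.
  have := sqn_ge0 xi; have := sqn_ge0 eta; nra.
apply: le_trans (_ : _ <= Mconst xi eta w + \sum_j weight x.2 j * Mblk j eta) _; last first.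
  apply: le_trans (H1 _ _ _ _ xT) _; rewrite lerN2 -mulrA ler_pM2l//.
  by rewrite ler_pdivrMl ?addr_gt0.
rewrite /lyapunov_flow flow_cl_error -/eta; apply: lerD => //.
rewrite flow_cl_plant -/eta -/y -/dz dot_mulmx trmx_inv Wsym -/xi /Mconst.
move: sec; clear Vle; clearbody w dz xi; rewrite dzE /y xpE.
rewrite !(mulmxDl, mulNmx, mulmxA) !(dotDr, dotNr).
rewrite !dot_trmx.
have -> : dot xi (W *m K^T *m w) = dot w (K *m W *m xi).
  by rewrite -mulmxA dot_mulmx Wsym dot_trmx mulmxA.
lra.
Qed.

Lemma G_cl_Tset (x y : state) : G_cl T1 T2 x y -> Tset T2 y.2.
Proof.
move=> [i [[xT _] _ _ /andP[y1 y2] yk]] k; have [->|/yk->] := eqVneq k i.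
  by rewrite y2 andbT (le_trans _ y1)// ltW.
exact: xT.
Qed.

(** Resetting timer [i] can raise its weight, but that weight multiplies the block which the same
    jump sets to zero. *)
Lemma lyapunov_jump (x y : state) : G_cl T1 T2 x y -> lyapunov y <= lyapunov x.
Proof.
move=> [i [_ y11 y12 _ yk]]; rewrite /lyapunov y11 lerD2l.
have sub j : submxcol (hblk i x.1.2) j = (if j == i then 0 else 1%:M) *m submxcol x.1.2 j.
  by rewrite /hblk mxdiag_mulmx mxcolK.
apply: ler_sum => j _; rewrite y12 sub; case: eqVneq => [->|ji].
  by rewrite mul0mx dot0l mulr0 mulr_ge0 ?expR_ge0//; exact: blkform_ge0.
by rewrite mul1mx yk.
Qed.

(** The point [(0, 0, x.2)] keeps the timers, lies in the set and realises the infimum. *)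
Lemma distA_C (x : state) : Tset T2 x.2 -> distA T2 x = Num.sqrt (sqn x.1.1 + sqn x.1.2).
Proof.
move=> xT; apply/eqP; rewrite eq_le; apply/andP; split.
  apply: ge_inf; first by exists 0 => _ [y _ <-]; exact: sqrtr_ge0.
  exists (0, 0, x.2) => //; rewrite /eucl /=; congr Num.sqrt.
  rewrite [X in _ + _ + X]big1 => [|i _]; last by rewrite !mxE subrr expr0n.
  by rewrite addr0; congr (_ + _); apply: eq_bigr => i _; rewrite !mxE subr0.
apply: lb_le_inf; first by exists (eucl (x - (0, 0, x.2))), (0, 0, x.2).
move=> _ [y [y1 [y2 yT]] <-]; rewrite /eucl ler_wsqrtr//= y1 y2.
apply: ler_wpDr; first by apply: sumr_ge0 => i _; exact: sqr_ge0.
by rewrite le_eqVlt; apply/orP; left; apply/eqP; congr (_ + _);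
  apply: eq_bigr => i _; rewrite !mxE subr0.
Qed.

Lemma lyapunov_ge0 x : 0 <= lyapunov x.
Proof.
apply: addr_ge0; first by apply: posdef_dot_ge0; exact: posdef_invmx.
by apply: sumr_ge0 => j _; rewrite mulr_ge0 ?expR_ge0//; exact: blkform_ge0.
Qed.

End Lyapunov.

(** * Calculus along the flow *)

Section VectorCalculus.
Variable R : realType.

Lemma is_derive_mxP m n (M : R -> 'M[R]_(m, n)) (t : R) (D : 'M[R]_(m, n)) :
  is_derive t 1 M D <-> forall i j, is_derive t 1 (fun s => M s i j) (D i j).
Proof.
split=> [[dM <-] i j|H].
  by split; [exact: (derivable_mxP M t 1).1|rewrite derive_mx// mxE].
have dM : derivable M t 1 by apply/derivable_mxP => i j; case: (H i j).
split=> //; rewrite derive_mx//; apply/matrixP => i j; rewrite mxE.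
exact: (@derive_val _ _ _ _ _ _ _ (H i j)).
Qed.

Lemma is_derive_pairP (X Y : normedModType R) (f : R -> X * Y) (t : R) (d : X * Y) :
  is_derive t 1 f d <->
  is_derive t 1 (fun s => (f s).1) d.1 /\ is_derive t 1 (fun s => (f s).2) d.2.
Proof.
split=> [/is_deriveP H|[/is_deriveP H1 /is_deriveP H2]].
  split; apply/is_deriveP => e /H[r r0 rH]; exists r => // s /rH;
    by rewrite prod_normE ge_max => /andP[].
apply/is_deriveP => e e0; have [r1 r10 h1] := H1 e e0; have [r2 r20 h2] := H2 e e0.
exists (Num.min r1 r2); first by rewrite lt_min r10.
by move=> s; rewrite lt_min => /andP[/h1 p1 /h2 p2]; rewrite prod_normE ge_max p1.
Qed.

Lemma is_derive_bigsum k (F : 'I_k -> R -> R) (d : 'I_k -> R) (t : R) :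
  (forall i, is_derive t 1 (F i) (d i)) ->
  is_derive t 1 (fun s => \sum_i F i s) (\sum_i d i).
Proof.
move=> H; have -> : (fun s => \sum_i F i s) = \sum_i F i.
  by apply/funext => s; rewrite fct_sumE.
exact: is_derive_sum.
Qed.

Lemma is_derive_mulmx k l (M : 'M[R]_(k, l)) (u : R -> 'cV[R]_l) (t : R) (d : 'cV[R]_l) :
  is_derive t 1 u d -> is_derive t 1 (fun s => M *m u s) (M *m d).
Proof.
move=> /is_derive_mxP H; apply/is_derive_mxP => i j; rewrite mxE.
rewrite (_ : (fun s => _) = fun s => \sum_k M i k * u s k j); last first.
  by apply/funext => s; rewrite mxE.
by apply: is_derive_bigsum => a; apply: is_deriveZ; exact: H.
Qed.

Lemma is_derive_dot k (u v : R -> 'cV[R]_k) (t : R) (du dv : 'cV[R]_k) :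
  is_derive t 1 u du -> is_derive t 1 v dv ->
  is_derive t 1 (fun s => dot (u s) (v s)) (dot du (v t) + dot (u t) dv).
Proof.
move=> /is_derive_mxP Hu /is_derive_mxP Hv.
rewrite (_ : (fun s => _) = fun s => \sum_k u s k 0 * v s k 0); last first.
  by apply/funext => s; rewrite dotE.
rewrite !dotE -big_split /=; apply: is_derive_bigsum => i.
have := is_deriveM (Hu i 0) (Hv i 0); move/is_derive_eq; apply.
by rewrite addrC /GRing.scale /= (mulrC (v t i 0)).
Qed.

Lemma is_derive_quad k (M : 'M[R]_k) (u : R -> 'cV[R]_k) (t : R) (du : 'cV[R]_k) : M^T = M ->
  is_derive t 1 u du ->
  is_derive t 1 (fun s => dot (u s) (M *m u s)) (2 * dot (u t) (M *m du)).
Proof.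
move=> MT Hu; have := is_derive_dot Hu (is_derive_mulmx M Hu).
by move/is_derive_eq; apply; rewrite dot_mulmx MT (dotC (M *m du)); ring.
Qed.

Lemma continuous_add (T : topologicalType) (X : normedModType R) (f g : T -> X) :
  continuous f -> continuous g -> continuous (fun s => f s + g s).
Proof. by move=> fc gc x; exact: (cvgD (fc x) (gc x)). Qed.

Lemma continuous_sub (T : topologicalType) (X : normedModType R) (f g : T -> X) :
  continuous f -> continuous g -> continuous (fun s => f s - g s).
Proof. by move=> fc gc x; exact: (cvgB (fc x) (gc x)). Qed.

Lemma continuous_mulr (T : topologicalType) (f g : T -> R) :
  continuous f -> continuous g -> continuous (fun s => f s * g s).
Proof. by move=> fc gc x; exact: (cvgM (fc x) (gc x)). Qed.

Lemma continuous_bigsum (T : topologicalType) k (F : 'I_k -> T -> R) :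
  (forall i, continuous (F i)) -> continuous (fun s => \sum_i F i s).
Proof.
move=> H x; rewrite (_ : (fun s => _) = \sum_i F i); last first.
  by apply/funext => s; rewrite fct_sumE.
elim/big_ind : _ => [|f g hf hg|i _]; first exact: cvg_cst.
  by apply: cvgD.
exact: H.
Qed.

Lemma continuous_mulmx (T : topologicalType) k l (M : 'M[R]_(k, l)) (u : T -> 'cV[R]_l) :
  continuous u -> continuous (fun s => M *m u s).
Proof.
move=> /continuous_mxP H; apply/continuous_mxP => i j.
rewrite (_ : (fun s => _) = fun s => \sum_k M i k * u s k j); last first.
  by apply/funext => s; rewrite mxE.
by apply: continuous_bigsum => a x; apply: cvgM; [exact: cvg_cst|exact: H].
Qed.

Lemma continuous_dot (T : topologicalType) k (u v : T -> 'cV[R]_k) :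
  continuous u -> continuous v -> continuous (fun s => dot (u s) (v s)).
Proof.
move=> /continuous_mxP Hu /continuous_mxP Hv.
rewrite (_ : (fun s => _) = fun s => \sum_k u s k 0 * v s k 0); last first.
  by apply/funext => s; rewrite dotE.
by apply: continuous_bigsum => a x; apply: cvgM; [exact: Hu|exact: Hv].
Qed.

(** Seen as a projection, the saturation is 1-Lipschitz, whence the constant 2 for the deadzone. *)
Lemma sat_clip (u y : R) : 0 < u -> Num.min `|y| u * Num.sg y = clip (- u) u y.
Proof.
move=> u0; have [y0|y0|->] := ltgtP y 0.
- rewrite (ltr0_sg y0) (ltr0_norm y0) /clip /Num.min /Num.max.
  by do ! case: ifPn; rewrite -?leNgt => *; lra.
- rewrite (gtr0_sg y0) (gtr0_norm y0) /clip /Num.min /Num.max.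
  by do ! case: ifPn; rewrite -?leNgt => *; lra.
- rewrite sgr0 mulr0 clip_id//; apply/andP; split; lra.
Qed.

Lemma dzv_lipschitz m (ubar : 'I_m -> R) (v w : 'cV[R]_m) : (forall i, 0 < ubar i) ->
  `|dzv ubar v - dzv ubar w| <= 2 * `|v - w|.
Proof.
move=> u0; apply: mx_norm_le; first by rewrite mulr_ge0.
move=> i j; rewrite /dzv /satv !mxE !sat_clip// (ord1 j).
have h1 : `|v i 0 - w i 0| <= `|v - w|.
  by have := entry_norm_le (v - w) i 0; rewrite !mxE.
have uu : - ubar i <= ubar i by have := u0 i; lra.
have h2 := clip_dist (v i 0) (w i 0) uu.
set a := clip _ _ (v i 0) in h2 *; set b := clip _ _ (w i 0) in h2 *.
have -> : a - v i 0 - (b - w i 0) = (a - b) - (v i 0 - w i 0) by ring.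
by apply: le_trans (ler_normB _ _) _; lra.
Qed.

Lemma dzv_continuous (T : topologicalType) m (ubar : 'I_m -> R) (y : T -> 'cV[R]_m) :
  (forall i, 0 < ubar i) -> continuous y -> continuous (fun s => dzv ubar (y s)).
Proof.
move=> u0 yc x; apply: (@continuous_comp _ _ _ y (dzv ubar)); first exact: yc.
by apply: (lipschitz_continuous (L := 2)) => // v w; exact: dzv_lipschitz.
Qed.

End VectorCalculus.

Section FlowCalculus.
Variables (R : realType) (m q : nat) (ns : 'I_q -> nat).
Local Notation n := (\sum_(i < q) ns i)%N.
Local Notation state := ('cV[R]_n * 'cV[R]_n * 'cV[R]_q)%type.
Variables (A : 'M[R]_n) (B : 'M[R]_(n, m)) (K : 'M[R]_(m, n)) (ubar : 'I_m -> R)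
  (W : 'M[R]_n) (Rb : forall j : 'I_q, 'M[R]_(ns j)) (sigma : 'I_q -> R).
Hypothesis ubar_gt0 : forall i, 0 < ubar i.
Hypothesis Wsym : (invmx W)^T = invmx W.
Hypothesis Rsym : forall j, (Rb j)^T = Rb j.

(** The timers do not enter the motion of plant and error, so Picard iteration is needed only for
    this field; the timers are solved explicitly. *)
Definition xbar_flow (z : 'cV[R]_(n + n)) : 'cV[R]_(n + n) :=
  Acl A B K *m z + Bcl B *m dzv ubar (Kcl K *m z).

Lemma xbar_flow_lipschitz : exists2 L, 0 < L &
  forall z w, `|xbar_flow z - xbar_flow w| <= L * `|z - w|.
Proof.
pose a := (n + n)%:R * `|Acl A B K|; pose b := m%:R * `|Bcl B|.
pose c := (n + n)%:R * `|Kcl K|.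
have a0 : 0 <= a by rewrite mulr_ge0.
have b0 : 0 <= b by rewrite mulr_ge0.
have c0 : 0 <= c by rewrite mulr_ge0.
exists (1 + a + b * (2 * c)); first by have := mulr_ge0 b0 c0; lra.
move=> z w; rewrite /xbar_flow opprD addrACA -!mulmxBr.
apply: le_trans (ler_normD _ _) _.
have h1 := mulmx_norm_le (Acl A B K) (z - w).
have h2 := mulmx_norm_le (Bcl B) (dzv ubar (Kcl K *m z) - dzv ubar (Kcl K *m w)).
have h3 := dzv_lipschitz (Kcl K *m z) (Kcl K *m w) ubar_gt0.
have h4 := mulmx_norm_le (Kcl K) (z - w); rewrite mulmxBr in h4.
rewrite -/a in h1; rewrite -/b in h2; rewrite -/c in h4.
have zw := normr_ge0 (z - w).
have h5 : b * `|dzv ubar (Kcl K *m z) - dzv ubar (Kcl K *m w)| <= b * (2 * (c * `|z - w|)).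
  by apply: ler_wpM2l => //; lra.
lra.
Qed.

Lemma flow_cl_continuous (phi : R -> state) :
  continuous (fun s => (phi s).1.1) -> continuous (fun s => (phi s).1.2) ->
  continuous (fun s => (flow_cl A B K ubar (phi s)).1.1) /\
  continuous (fun s => (flow_cl A B K ubar (phi s)).1.2).
Proof.
move=> c1 c2; split.
  rewrite (_ : (fun s => _) = fun s => (A + B *m K) *m (phi s).1.1 - B *m K *m (phi s).1.2
     + B *m dzv ubar (K *m (phi s).1.1 - K *m (phi s).1.2)); last first.
    by apply/funext => s; rewrite flow_cl_plant.
  have dc : continuous (fun s => dzv ubar (K *m (phi s).1.1 - K *m (phi s).1.2)).
    apply: dzv_continuous => //.
    exact: (continuous_sub (continuous_mulmx (M := K) c1) (continuous_mulmx (M := K) c2)).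
  apply: continuous_add (continuous_mulmx (M := B) dc).
  exact: (continuous_sub (continuous_mulmx c1) (continuous_mulmx c2)).
rewrite (_ : (fun s => _) = fun s => A *m (phi s).1.2); last first.
  by apply/funext => s; rewrite flow_cl_error.
exact: continuous_mulmx.
Qed.

Let submxcol_continuous (u : R -> 'cV[R]_n) j :
  continuous u -> continuous (fun s => submxcol (u s) j).
Proof.
move=> /continuous_mxP H; apply/continuous_mxP => a b.
rewrite (_ : (fun s => _) = fun s => u s (tagnat.Rank j a) b); first exact: H.
by apply/funext => s; rewrite mxE.
Qed.

Let weight_continuous (phi : R -> state) j : continuous (fun s => (phi s).2) ->
  continuous (fun s => expR (sigma j * (phi s).2 j 0)).
Proof.
move=> /continuous_mxP H x.
apply: (@continuous_comp _ _ _ (fun s => sigma j * (phi s).2 j 0) expR).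
  by apply: cvgM; [exact: cvg_cst|exact: H].
exact: continuous_expR.
Qed.

Lemma lyapunov_continuous (phi : R -> state) :
  continuous (fun s => (phi s).1.1) -> continuous (fun s => (phi s).1.2) ->
  continuous (fun s => (phi s).2) ->
  continuous (fun s => lyapunov W Rb sigma (phi s)) /\
  continuous (fun s => lyapunov_flow A B K ubar W Rb sigma (phi s)).
Proof.
move=> c1 c2 c3; have [f1 f2] := flow_cl_continuous c1 c2.
have s2 j := @submxcol_continuous _ j c2; have s3 j := @submxcol_continuous _ j f2.
have w j := @weight_continuous phi j c3.
have cc (c : R) : continuous (fun _ : R => c) by move=> x; exact: cvg_cst.
have qf j := continuous_dot (@s2 j) (continuous_mulmx (M := Rb j) (@s2 j)).
split.
  apply: continuous_add; first exact: (continuous_dot c1 (continuous_mulmx (M := invmx W) c1)).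
  by apply: continuous_bigsum => j; exact: (continuous_mulr (@w j) (@qf j)).
apply: continuous_add.
  exact: (continuous_mulr (@cc 2) (continuous_dot c1 (continuous_mulmx (M := invmx W) f1))).
apply: continuous_bigsum => j; apply: (continuous_mulr (@w j)).
apply: continuous_sub; last exact: (continuous_mulr (@cc (sigma j)) (@qf j)).
exact: (continuous_mulr (@cc 2) (continuous_dot (@s2 j) (continuous_mulmx (M := Rb j) (@s3 j)))).
Qed.

Lemma is_derive_lyapunov (phi : R -> state) (t : R) :
  is_derive t 1 phi (flow_cl A B K ubar (phi t)) ->
  is_derive t 1 (fun s => lyapunov W Rb sigma (phi s))
    (lyapunov_flow A B K ubar W Rb sigma (phi t)).
Proof.
move=> /is_derive_pairP[/is_derive_pairP[d1 d2] d3].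
apply: (is_deriveD (is_derive_quad Wsym d1)).
apply: is_derive_bigsum => j.
have ds : is_derive t 1 (fun s => submxcol (phi s).1.2 j)
    (submxcol (flow_cl A B K ubar (phi t)).1.2 j).
  move/is_derive_mxP : d2 => d2; apply/is_derive_mxP => a b.
  rewrite (_ : (fun s => _) = fun s => (phi s).1.2 (tagnat.Rank j a) b); last first.
    by apply/funext => s; rewrite mxE.
  by rewrite mxE; exact: d2.
have dw : is_derive t 1 (fun s => expR (sigma j * (phi s).2 j 0))
    (- sigma j * expR (sigma j * (phi t).2 j 0)).
  move/is_derive_mxP : d3 => /(_ j 0); rewrite !mxE => d3.
  have d4 : is_derive t 1 (fun s => sigma j * (phi s).2 j 0) (- sigma j).
    by have := is_deriveZ (sigma j) d3; move/is_derive_eq; apply; rewrite /GRing.scale /= mulrN1.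
  have := @is_derive1_comp _ expR (fun s => sigma j * (phi s).2 j 0) t _ _ (is_derive_expR _) d4.
  by move/is_derive_eq; apply; rewrite mulrC.
have := is_deriveM dw (is_derive_quad (Rsym j) ds); move/is_derive_eq; apply.
rewrite /GRing.scale /=; ring.
Qed.

End FlowCalculus.

(** * Hybrid time domains and extension of solutions *)

Section HybridTime.
Variable R : realType.
Implicit Types (E : set (R * nat)).

(** The jump times of [E] up to [(T, J)], normalised so that the last piece has index exactly [J]
    and ends at [T]; [compact_htd] leaves both unspecified. *)
Definition htd_cut E (T : R) (J : nat) (t : nat -> R) : Prop :=
  [/\ t 0%N = 0, forall j, (j <= J)%N -> t j <= t j.+1, t J.+1 = T &
      forall s i, (E (s, i) /\ s <= T /\ (i <= J)%N) <->
                  ((i <= J)%N /\ t i <= s <= t i.+1)].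

Lemma htd_cut_exists E T J : hybrid_time_domain E -> E (T, J) -> exists t, htd_cut E T J t.
Proof.
move=> [_ H] ETJ; have [J' [t [t0 tm EE]]] := H _ _ ETJ.
have iff s i : (E (s, i) /\ s <= T /\ (i <= J)%N) <-> ((i <= J')%N /\ t i <= s <= t i.+1).
  rewrite -[X in X <-> _]/((E `&` [set p | p.1 <= T /\ (p.2 <= J)%N]) (s, i)).
  by rewrite EE.
have [] := (iff T J).1 (conj ETJ (conj (lexx _) (leqnn _))) => JJ' /andP[_ TJ].
have [|_ [_ J'J]] := (iff (t J') J').2; first by rewrite leqnn lexx tm.
have JE : J' = J by apply/eqP; rewrite eqn_leq J'J JJ'.
subst J'; exists t; split=> //; apply/eqP; rewrite eq_le TJ andbT.
by have [|_ [? _]] := (iff (t J.+1) J).2; first by rewrite leqnn lexx andbT tm.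
Qed.

Lemma htd_itv E a b s j : hybrid_time_domain E ->
  E (a, j) -> E (b, j) -> a <= s <= b -> E (s, j).
Proof.
move=> hE Ea Eb /andP[as_ sb]; have [t [_ _ _ iff]] := htd_cut_exists hE Eb.
have [|_ /andP[ta _]] := (iff a j).1; first by rewrite (le_trans as_ sb).
have [|_ /andP[_ tb]] := (iff b j).1; first by rewrite lexx.
by have [|] := (iff s j).2; first by rewrite leqnn (le_trans ta as_) (le_trans sb tb).
Qed.

Lemma htd_ind E (P : R -> nat -> Prop) : hybrid_time_domain E -> P 0 0%N ->
  (forall a b j, a <= b -> E (a, j) -> E (b, j) -> P a j -> P b j) ->
  (forall t j, E (t, j) -> E (t, j.+1) -> P t j -> P t j.+1) ->
  forall t j, E (t, j) -> P t j.
Proof.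
move=> hE P0 Pf Pj T J ETJ; have [t [t0 tm tT iff]] := htd_cut_exists hE ETJ.
have Et s i : (i <= J)%N -> t i <= s <= t i.+1 -> E (s, i).
  by move=> iJ si; have [] := (iff s i).2 (conj iJ si).
suff main i : (i <= J)%N -> P (t i.+1) i by rewrite -tT; exact: main.
elim: i => [_|i IH iJ].
  apply: (Pf (t 0%N)); rewrite ?t0 -?t0; try exact: tm.
  - by apply: Et => //; rewrite lexx tm.
  - by apply: Et => //; rewrite lexx andbT tm.
  - by rewrite t0.
have iJ' := ltnW iJ.
have E1 : E (t i.+1, i.+1) by apply: Et => //; rewrite lexx tm.
apply: (Pf (t i.+1)) => //; first exact: tm.
  by apply: Et => //; rewrite lexx andbT tm.
apply: Pj => //; last exact: IH.
by apply: Et => //; rewrite lexx andbT tm.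
Qed.

Lemma htd_jump_before E T J i : hybrid_time_domain E -> E (T, J) -> (i < J)%N ->
  exists s, [/\ s <= T, E (s, i) & E (s, i.+1)].
Proof.
move=> hE ETJ iJ; have [t [t0 tm tT iff]] := htd_cut_exists hE ETJ.
have Et s k : (k <= J)%N -> t k <= s <= t k.+1 -> E (s, k) /\ s <= T.
  by move=> kJ sk; have [? []] := (iff s k).2 (conj kJ sk).
have iJ' := ltnW iJ.
have [E2 sT] : E (t i.+1, i.+1) /\ t i.+1 <= T by apply: Et => //; rewrite lexx tm.
exists (t i.+1); split=> //.
by have [] := Et (t i.+1) i iJ'; first by rewrite lexx andbT tm.
Qed.

Lemma htd_of_cuts E : (forall p, E p -> 0 <= p.1) ->
  (forall T J, E (T, J) -> exists t, htd_cut E T J t) -> hybrid_time_domain E.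
Proof.
move=> E0 H; split=> // T J /H[t [t0 tm tT iff]]; exists J, t; split=> //.
by apply/seteqP; split=> -[s i] /=; have := iff s i; [case=> + _|case=> _ +]; tauto.
Qed.

(** The added interval may overlap [E]: it starts at a time [t0] already reached at level [J]. One
    construction thus closes a half-open flow interval and prolongs a closed one. *)
Definition flow_extension E (J : nat) (t0 T : R) : set (R * nat) :=
  [set p | E p \/ (p.2 = J /\ t0 <= p.1 <= T)].

Definition jump_extension E (J : nat) (T : R) : set (R * nat) :=
  [set p | E p \/ p = (T, J.+1)].

Lemma htd_cut_same E E' T J t : (forall s i, s <= T -> (i <= J)%N -> E' (s, i) <-> E (s, i)) ->
  htd_cut E T J t -> htd_cut E' T J t.
Proof.
move=> EE [t0 tm tT iff]; split=> // s i; rewrite -iff.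
by split=> -[Esi [sT iJ]]; split=> //; apply/EE.
Qed.

Lemma htd_flow_extension E J t0 T : hybrid_time_domain E ->
  (forall t i, E (t, i) -> (i < J)%N -> t <= t0) ->
  (forall t j, E (t, j) -> (j <= J)%N) -> E (t0, J) ->
  hybrid_time_domain (flow_extension E J t0 T).
Proof.
move=> hE mono top Et0; have t00 : 0 <= t0 := hE.1 _ Et0.
apply: htd_of_cuts => [[s i] [/hE.1//|[/= _ /andP[ts _]]]|S j].
  exact: le_trans ts.
have [ESj _|nE] := pselect (E (S, j)).
  have [t ht] := htd_cut_exists hE ESj; exists t; apply: htd_cut_same ht => s i sS ij.
  split=> [[//|[/= iJ /andP[ts _]]]|]; last by left.
  have jJ : j = J by apply/eqP; rewrite eqn_leq (top _ _ ESj) -iJ ij.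
  by rewrite iJ; apply: (htd_itv hE Et0 (b := S)); rewrite ?ts// -jJ.
move=> [//|[/= -> {j nE} /andP[tS ST]]].
have [t [t_0 tm tT iff]] := htd_cut_exists hE Et0.
(* The jump times of the cut at [(t0, J)], with only the final time moved to [S]. *)
exists (fun k => if k == J.+1 then S else t k); split=> //.
- move=> j jJ; rewrite ltn_eqF ?ltnS// eqSS; case: eqVneq => [->|_]; last exact: tm.
  by apply: le_trans tS; rewrite -tT tm.
- by rewrite eqxx.
- move=> s i; split.
    move=> [[Esi|[/= -> /andP[ts sT]]] [sS iJ]].
      split=> //; rewrite ltn_eqF ?ltnS// eqSS; case: eqVneq => [iE|iE].
        subst i; rewrite sS andbT; have [st0|/ltW t0s] := leP s t0.
          by have [_ /andP[]] := (iff s J).1 (conj Esi (conj st0 iJ)).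
        by apply: le_trans t0s; rewrite -tT tm.
      have iJ' : (i < J)%N by rewrite ltn_neqAle iE.
      by have [] := (iff s i).1 (conj Esi (conj (mono _ _ Esi iJ') iJ)).
    split=> //; rewrite ltn_eqF// eqxx sS andbT.
    by apply: le_trans ts; rewrite -tT tm.
  move=> [iJ]; rewrite ltn_eqF ?ltnS// eqSS; case: eqVneq => [->|iE] /andP[ts sS].
    split=> //; have [st0|/ltW t0s] := leP s t0.
      by left; have [] := (iff s J).2; first by rewrite leqnn ts tT.
    by right; rewrite /= t0s (le_trans sS ST).
  have [|Esi [st0 _]] := (iff s i).2; first by rewrite iJ ts.
  by split; [left|rewrite (le_trans st0 tS)].
Qed.

Lemma htd_jump_extension E J T : hybrid_time_domain E ->
  (forall t i, E (t, i) -> t <= T) ->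
  (forall t j, E (t, j) -> (j <= J)%N) -> E (T, J) ->
  hybrid_time_domain (jump_extension E J T).
Proof.
move=> hE mono top ET.
apply: htd_of_cuts => [p [/hE.1//|->]|S j [ESj|[-> ->]]]; first exact: hE.1 _ ET.
  have [t ht] := htd_cut_exists hE ESj; exists t; apply: htd_cut_same ht => s i sS ij.
  split=> [[//|[_ iJ]]|]; last by left.
  by have := leq_trans ij (top _ _ ESj); rewrite iJ ltnn.
have [t [t_0 tm tT iff]] := htd_cut_exists hE ET.
(* Since [t J.+1 = T], the new entry makes the piece of index [J.+1] the single time [T]. *)
exists (fun k => if k == J.+2 then T else t k); split=> //.
- move=> k kJ; rewrite ltn_eqF ?ltnS// eqSS; case: eqVneq => [->|kE]; first by rewrite tT.
  by apply: tm; rewrite -ltnS ltn_neqAle kE.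
- by rewrite eqxx.
- move=> s i; split.
    move=> [[Esi|[-> ->]] [sS iJ]]; split=> //; rewrite ltn_eqF ?ltnS// eqSS.
      have iJ' := top _ _ Esi.
      by rewrite ltn_eqF ?ltnS//; have [] := (iff s i).1 (conj Esi (conj sS iJ')).
    by rewrite eqxx tT lexx.
  move=> [iJ]; rewrite ltn_eqF ?ltnS// eqSS; case: eqVneq => [->|iE] /andP[ts sS].
    split=> //; right; congr (_, _); apply/eqP; rewrite eq_le sS -tT ts //.
  have iJ' : (i <= J)%N by rewrite -ltnS ltn_neqAle iE.
  have [|Esi [st0 _]] := (iff s i).2; first by rewrite iJ' ts.
  by split; [left|].
Qed.

End HybridTime.

(** * Prolonging a solution by a flow piece or by a jump *)

Section Extension.
Variables (R : realType) (X : normedModType R).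
Variables (C : set X) (f : X -> X) (D : set X) (G : X -> set X).
Variables (E : set (R * nat)) (phi : R -> nat -> X) (J : nat).
Hypothesis sol : is_solution C f D G E phi.
Hypothesis top : forall t j, E (t, j) -> (j <= J)%N.
Notation mu := (@lebesgue_measure R).

Let hE : hybrid_time_domain E. Proof. by case: sol. Qed.

Lemma solution_flow_extension t0 T (y : R -> X) :
  (forall t i, E (t, i) -> (i < J)%N -> t <= t0) -> E (t0, J) ->
  (forall t, E (t, J) -> t <= T) ->
  (forall t, E (t, J) -> t0 <= t -> y t = phi t J) ->
  abs_cont_on t0 T y -> (forall t, t0 <= t <= T -> C (y t)) ->
  {ae mu, forall t, t0 < t < T -> is_derive t 1 y (f (y t))} ->
  is_solution C f D G (flow_extension E J t0 T)
    (fun t j => if (j == J) && (t0 <= t) then y t else phi t j).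
Proof.
move=> mono Et0 ET yphi yAC yC yd.
have [_ [E0 phi0] sAC sflow sjump] := sol.
set psi := fun t j => _; set E' := flow_extension _ _ _ _.
have t0T := ET _ Et0.
have psiE t j : E (t, j) -> psi t j = phi t j.
  move=> Etj; rewrite /psi; case: eqVneq => //= jJ; subst j; case: ifPn => // t0t.
  exact: yphi.
have Elt j t : E' (t, j) -> (j != J) || (t <= t0) -> E (t, j).
  move=> [//|/= [jJ /andP[t0t _]]]; rewrite jJ eqxx /= => tt0.
  by have -> : t = t0 by apply/eqP; rewrite eq_le tt0.
have E'J t : E' (t, J) -> t <= T by move=> [/ET//|/= [_ /andP[]]].
split.
- exact: htd_flow_extension.
- by split; [left|rewrite psiE].
- move=> j a b ab abE'; have [jJ|jJ] := eqVneq j J; last first.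
    apply: (@abs_cont_on_eq _ _ _ _ (fun t => phi t j)).
      by move=> t _; rewrite /psi (negbTE jJ).
    apply: sAC => // t tab; apply: Elt; rewrite ?jJ//; exact: abE'.
  subst j; rewrite /psi eqxx /=.
  have aE : E' (a, J) by apply: abE'; rewrite /= in_itv /= lexx.
  have bE : E' (b, J) by apply: abE'; rewrite /= in_itv /= lexx andbT.
  have ACr c : t0 <= c -> abs_cont_on c b (fun t => if t0 <= t then y t else phi t J).
    move=> tc; apply: (@abs_cont_on_eq _ _ _ _ y) => [t /andP[ct _]|].
      by rewrite (le_trans tc ct).
    by apply: abs_cont_onW yAC => //; exact: E'J.
  have ACl c : c <= t0 -> c <= b -> abs_cont_on a c (fun t => if t0 <= t then y t else phi t J).
    move=> ct cb; apply: (@abs_cont_on_eq _ _ _ _ (fun t => phi t J)).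
      move=> t /andP[at_ tc]; case: ifPn => // t0t; rewrite yphi//.
      by have -> : t = t0 by apply/eqP; rewrite eq_le t0t (le_trans tc ct).
    have [ac|ca] := leP a c.
      apply: sAC => // t; rewrite /= in_itv /= => /andP[at_ tc].
      apply: Elt; last by rewrite (le_trans tc ct) orbT.
      by apply: abE'; rewrite /= in_itv /= at_ (le_trans tc cb).
    apply: (@abs_cont_on_lipschitz _ _ _ _ 0) => s t as_ st tc.
    by move: (le_lt_trans (le_trans as_ (le_trans st tc)) ca); rewrite ltxx.
  have [t0a|at0] := leP t0 a; first exact: ACr.
  have [bt0|t0b] := leP b t0; first exact: ACl.
  by apply: (@abs_cont_on_cat _ _ _ _ t0); [exact: ltW|exact: ltW|exact: ACl (ltW _)|exact: ACr].
- move=> j; have [sC sd] := sflow j.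
  have intE t : interior [set s | E' (s, j)] t -> (j != J) || (t < t0) ->
      interior [set s | E (s, j)] t.
    move=> /interiorRP[r r0 rH] jt; apply/interiorRP.
    have [jJ|jJ] := eqVneq j J; last first.
      by exists r => // s /rH/Elt; apply; rewrite jJ.
    rewrite jJ eqxx /= in jt.
    exists (Num.min r (t0 - t)); first by rewrite lt_min r0 subr_gt0.
    move=> s; rewrite lt_min => /andP[/rH sE st]; apply: Elt => //.
    by apply/orP; right; move: st; rewrite ltr_norml => /andP[? ?]; lra.
  have intT t : interior [set s | E' (s, j)] t -> j = J -> t < T.
    move=> /interiorRP[r r0 rH] jJ; subst j.
    have /rH/E'J : `|t - (t + r / 2)| < r.
      by rewrite opprD addrA subrr add0r normrN gtr0_norm; lra.
    lra.
  split=> [t tI|].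
    rewrite /psi; case: eqVneq => [jJ|jJ] /=; last by apply: sC; apply: intE => //; rewrite jJ.
    case: leP => tt0; first by apply: yC; rewrite tt0 ltW// intT.
    by apply: sC; apply: intE => //; rewrite tt0 orbT.
  (* Nothing is known about the derivative at the splice [t0], but a single time is negligible. *)
  have nul : {ae mu, forall t, t != t0}.
    exists [set t0]; split=> //; first exact: lebesgue_measure_set1.
    by move=> t /= /negP; rewrite negbK => /eqP.
  have : {ae mu, forall t, (interior [set s | E (s, j)] t ->
       is_derive t 1 (fun s => phi s j) (f (phi t j))) /\
     (t0 < t < T -> is_derive t 1 y (f (y t))) /\ t != t0}.
    exact: ae_lebesgueI sd (ae_lebesgueI yd nul).
  apply: ae_lebesgueS => t [h1 [h2 tt0]] tI.
  have [jJ|jJ] := eqVneq j J; last first.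
    rewrite (_ : (fun s => psi s j) = fun s => phi s j); last first.
      by apply/funext => s; rewrite /psi (negbTE jJ).
    by rewrite /psi (negbTE jJ); apply: h1; apply: intE => //; rewrite jJ.
  case: (ltgtP t t0) tt0 => // tt0 _.
    have -> : psi t j = phi t j by rewrite /psi leNgt tt0 andbF.
    apply: (@is_derive_near _ _ (fun s => phi s j) _ _ _ (t0 - t)); first by rewrite subr_gt0.
      move=> s st; rewrite /psi [t0 <= s]leNgt.
      have -> : s < t0 by move: st; rewrite ltr_norml => /andP[? ?]; lra.
      by rewrite andbF.
    by apply: h1; apply: intE => //; rewrite tt0 orbT.
  have -> : psi t j = y t by rewrite /psi jJ eqxx ltW.
  apply: (@is_derive_near _ _ y _ _ _ (t - t0)); first by rewrite subr_gt0.
    move=> s st; rewrite /psi jJ eqxx /=.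
    by have -> : t0 <= s by move: st; rewrite ltr_norml => /andP[? ?]; lra.
  by apply: h2; rewrite tt0 intT.
- move=> t j Ej Ej1.
  have jJ : j != J.
    apply/eqP => jJ; subst j; case: Ej1 => [/top|/= [/eqP]]; first by rewrite ltnn.
    by rewrite eqn_leq ltnn.
  have Etj : E (t, j) by apply: Elt => //; rewrite jJ.
  rewrite psiE//.
  have Etj1 : E (t, j.+1).
    apply: Elt => //; apply/orP; right; apply: (mono _ _ Etj).
    by rewrite ltn_neqAle jJ (top Etj).
  by rewrite psiE//; exact: sjump.
Qed.

Lemma solution_jump_extension T y : E (T, J) -> (forall t i, E (t, i) -> t <= T) ->
  D (phi T J) -> G (phi T J) y ->
  is_solution C f D G (jump_extension E J T) (fun t j => if j == J.+1 then y else phi t j).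
Proof.
move=> ETJ mono DT Gy; have [_ [E0 phi0] sAC sflow sjump] := sol.
have nJ t : ~ E (t, J.+1) by move=> /top; rewrite ltnn.
have E'J t : jump_extension E J T (t, J.+1) -> t = T by move=> [/nJ|[]].
have E'n t j : j != J.+1 -> jump_extension E J T (t, j) -> E (t, j).
  by move=> jJ [//|[_ jE]]; rewrite jE eqxx in jJ.
have Eeq j : j != J.+1 -> [set t | jump_extension E J T (t, j)] = [set t | E (t, j)].
  by move=> jJ; apply/seteqP; split=> t /=; [exact: E'n|left].
(* Level [J.+1] consists of one time, so the flow conditions there are vacuous. *)
have int0 t : ~ interior [set s | jump_extension E J T (s, J.+1)] t.
  move=> /interiorRP[r r0 rH].
  have /rH/E'J h1 : `|t - t| < r by rewrite subrr normr0.
  have /rH/E'J h2 : `|t - (t + r / 2)| < r.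
    by rewrite opprD addrA subrr add0r normrN gtr0_norm; lra.
  lra.
split.
- exact: htd_jump_extension.
- by split; [left|].
- move=> j; case: eqVneq => [->|jJ]; last by rewrite Eeq.
  move=> a b ab abE.
  by apply: (@abs_cont_on_lipschitz _ _ _ _ 0) => s t _ _ _; rewrite subrr normr0 mul0r.
- move=> j; case: eqVneq => [->|jJ]; last by rewrite Eeq.
  split=> [t /int0//|].
  by apply: (ae_lebesgueS (P := fun=> True)); [move=> t _ /int0|exact: aeW].
- move=> t j Ej Ej1.
  have jJ : j != J.+1.
    apply/eqP => jJ; subst j; case: Ej1 => [/top|[_ /eqP]]; last by rewrite eqn_leq ltnn.
    by move/ltnW; rewrite ltnn.
  rewrite (negbTE jJ) eqSS; case: eqVneq => [jE|jE].
    by subst j; rewrite (E'J _ Ej1).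
  by apply: sjump; [exact: E'n|apply: E'n Ej1; rewrite eqSS].
Qed.

End Extension.

(** * Solutions of the closed loop *)

Section ClosedLoop.
Variables (R : realType) (m q : nat) (ns : 'I_q -> nat).
Local Notation n := (\sum_(i < q) ns i)%N.
Local Notation state := ('cV[R]_n * 'cV[R]_n * 'cV[R]_q)%type.
Variables (A : 'M[R]_n) (B : 'M[R]_(n, m)) (K : 'M[R]_(m, n))
  (ubar : 'I_m -> R) (T1 T2 : 'I_q -> R).
Hypothesis ubar_gt0 : forall i, 0 < ubar i.
Hypothesis T1_gt0 : forall i, 0 < T1 i.
Hypothesis T12 : forall i, T1 i <= T2 i.
Notation mu := (@lebesgue_measure R).
Local Notation flow := (flow_cl A B K ubar).
Local Notation C := (@C_cl R q ns T2).
Local Notation D := (@D_cl R q ns T2).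
Local Notation G := (@G_cl R q ns T1 T2).

Lemma state_entry_norm (x : state) :
  [/\ forall i, `|x.1.1 i 0| <= `|x|, forall i, `|x.1.2 i 0| <= `|x| &
      forall k, `|x.2 k 0| <= `|x|].
Proof.
have h1 : `|x.1| <= `|x| by rewrite [leRHS]prod_normE le_max lexx.
have h2 : `|x.2| <= `|x| by rewrite [leRHS]prod_normE le_max lexx orbT.
have h3 : `|x.1.1| <= `|x.1| by rewrite [leRHS]prod_normE le_max lexx.
have h4 : `|x.1.2| <= `|x.1| by rewrite [leRHS]prod_normE le_max lexx orbT.
split=> i.
- exact: le_trans (entry_norm_le _ _ _) (le_trans h3 h1).
- exact: le_trans (entry_norm_le _ _ _) (le_trans h4 h1).
- exact: le_trans (entry_norm_le _ _ _) h2.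
Qed.

Lemma state_norm_le (x : state) c : 0 <= c -> (forall i, `|x.1.1 i 0| <= c) ->
  (forall i, `|x.1.2 i 0| <= c) -> (forall k, `|x.2 k 0| <= c) -> `|x| <= c.
Proof.
move=> c0 h1 h2 h3; rewrite prod_normE ge_max prod_normE ge_max.
by rewrite !mx_norm_le// => i j; rewrite (ord1 j).
Qed.

Lemma closure_C_cl (x : state) : closure C x -> Tset T2 x.2.
Proof.
have key i e : 0 < e -> closure C x -> exists y : state, Tset T2 y.2 /\ `|x.2 i 0 - y.2 i 0| < e.
  move=> e0 /(_ (ball x e) (nbhsx_ballx _ _ e0))[y [Cy]].
  rewrite -ball_normE /= => xy; exists y; split=> //.
  by apply: le_lt_trans xy; have [_ _ /(_ i)] := state_entry_norm (x - y); rewrite !mxE.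
move=> cx i; apply/andP; split; rewrite leNgt; apply/negP => h.
  have h' : 0 < - x.2 i 0 by rewrite oppr_gt0.
  have [y [/(_ i)/andP[y0 _]]] := key i _ h' cx.
  by rewrite ltr_norml => /andP[? ?]; lra.
have h' : 0 < x.2 i 0 - T2 i by rewrite subr_gt0.
have [y [/(_ i)/andP[_ y0]]] := key i _ h' cx.
by rewrite ltr_norml => /andP[? ?]; lra.
Qed.

Section Solution.
Variables (E : set (R * nat)) (phi : R -> nat -> state).
Hypothesis sol : is_solution C flow D G E phi.

Let hE : hybrid_time_domain E. Proof. by case: sol. Qed.

Lemma initial_Tset : Tset T2 (phi 0 0%N).2.
Proof. by have [_ [_ [/closure_C_cl//|[]]]] := sol. Qed.

Lemma interior_segment a b j t : E (a, j) -> E (b, j) -> a < t < b ->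
  interior [set s | E (s, j)] t.
Proof.
move=> Ea Eb /andP[at_ tb]; apply/interiorRP.
exists (Num.min (t - a) (b - t)); first by rewrite lt_min !subr_gt0 at_.
move=> s; rewrite lt_min !ltr_norml => /andP[/andP[? ?] /andP[? ?]].
by apply: (htd_itv hE Ea Eb); apply/andP; split; lra.
Qed.

Lemma flow_segment a b j (u := fun s => phi (clip a b s) j) : a <= b -> E (a, j) -> E (b, j) ->
  [/\ continuous (fun s => (u s).1.1), continuous (fun s => (u s).1.2),
      continuous (fun s => (u s).2) &
      forall t, a < t < b -> is_derive t 1 u (flow (u t))].
Proof.
move=> ab Ea Eb; have [_ _ /(_ j a b ab) sAC /(_ j)[_ sd] _] := sol.
have {}sAC : abs_cont_on a b (fun t => phi t j).
  by apply: sAC => t; rewrite /= in_itv /=; exact: htd_itv Ea Eb.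
have AC1 i : abs_cont_on a b (fun t => (phi t j).1.1 i 0 : R).
  apply: abs_cont_on_le sAC => s t.
  by have [/(_ i) + _ _] := state_entry_norm (phi t j - phi s j); rewrite !mxE.
have AC2 i : abs_cont_on a b (fun t => (phi t j).1.2 i 0 : R).
  apply: abs_cont_on_le sAC => s t.
  by have [_ /(_ i) + _] := state_entry_norm (phi t j - phi s j); rewrite !mxE.
have AC3 i : abs_cont_on a b (fun t => (phi t j).2 i 0 : R).
  apply: abs_cont_on_le sAC => s t.
  by have [_ _ /(_ i)] := state_entry_norm (phi t j - phi s j); rewrite !mxE.
have c1 : continuous (fun s => (u s).1.1).
  by apply/continuous_mxP => i k; rewrite (ord1 k); exact: abs_cont_on_continuous ab (AC1 i).
have c2 : continuous (fun s => (u s).1.2).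
  by apply/continuous_mxP => i k; rewrite (ord1 k); exact: abs_cont_on_continuous ab (AC2 i).
have c3 : continuous (fun s => (u s).2).
  by apply/continuous_mxP => i k; rewrite (ord1 k); exact: abs_cont_on_continuous ab (AC3 i).
have [/continuous_mxP f1 /continuous_mxP f2] := flow_cl_continuous A B K ubar_gt0 c1 c2.
have aed : {ae mu, forall t, a < t < b -> is_derive t 1 (fun s => phi s j) (flow (u t))}.
  apply: ae_lebesgueS sd => t + tab; rewrite /u clip_id; last by case/andP: tab => *; rewrite !ltW.
  by apply; exact: interior_segment tab.
split=> // t tab.
apply: (is_derive_oo_near tab (f := fun s => phi s j)).
  by move=> s /andP[s1 s2]; rewrite /u clip_id// !ltW.
apply/is_derive_pairP; split; [apply/is_derive_pairP; split|]; apply/is_derive_mxP => i k;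
  rewrite (ord1 k).
- apply: (abs_cont_is_derive ab (AC1 i) (h := fun t => (flow (u t)).1.1 i 0)) => //.
  by apply: ae_lebesgueS aed => s sd' /sd'/is_derive_pairP[/is_derive_pairP[/is_derive_mxP]].
- apply: (abs_cont_is_derive ab (AC2 i) (h := fun t => (flow (u t)).1.2 i 0)) => //.
  by apply: ae_lebesgueS aed => s sd' /sd'/is_derive_pairP[/is_derive_pairP[_ /is_derive_mxP]].
- apply: (abs_cont_is_derive ab (AC3 i) (h := fun t => (flow (u t)).2 i 0)) => //.
    by move=> x; exact: cvg_cst.
  by apply: ae_lebesgueS aed => s sd' /sd'/is_derive_pairP[_ /is_derive_mxP].
Qed.

Lemma timer_segment a b j k : a <= b -> E (a, j) -> E (b, j) ->
  (phi b j).2 k 0 = (phi a j).2 k 0 - (b - a).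
Proof.
move=> ab Ea Eb; have [_ _ /continuous_mxP c3 d] := flow_segment ab Ea Eb.
pose g (s : R) : R := (phi (clip a b s) j).2 k 0 + s.
have gc : continuous g.
  by apply: continuous_add; [exact: c3|move=> x; exact: cvg_id].
have gd t : a < t < b -> is_derive t 1 g 0.
  move=> /d/is_derive_pairP[_ /is_derive_mxP/(_ k 0)]; rewrite !mxE => dk.
  by have := is_deriveD dk (is_derive_id t 1); rewrite addNr.
have : `|g b - g a| <= 0 * (b - a).
  by apply: (mean_value_norm_le (df := fun=> 0)) => // t _; rewrite normr0.
rewrite mul0r normr_le0 subr_eq0 /g !clip_id ?lexx ?ab// => /eqP gE.
by lra.
Qed.

(** A solution is required to stay in the flow set only at interior times; the endpoint follows
    because a timer negative at [b] would already be negative shortly before. *)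
Lemma Tset_segment a b j : a <= b -> E (a, j) -> E (b, j) ->
  Tset T2 (phi a j).2 -> Tset T2 (phi b j).2.
Proof.
move=> ab Ea Eb aT k; have /andP[a0 aT2] := aT k.
rewrite (timer_segment k ab Ea Eb); apply/andP; split; last by lra.
rewrite leNgt; apply/negP => h.
(* The midpoint between [b] and the time at which timer [k] reaches zero. *)
pose t := a + ((phi a j).2 k 0 + (b - a)) / 2.
have tab : a < t < b by rewrite /t; apply/andP; split; lra.
have Et : E (t, j) by apply: (htd_itv hE Ea Eb); case/andP: tab => *; rewrite !ltW.
have [_ _ _ /(_ j)[sC _] _] := sol.
have /(_ k) := sC t (interior_segment Ea Eb tab).
rewrite (timer_segment k _ Ea Et); last by case/andP: tab => *; rewrite ltW.
by rewrite /t => /andP[? ?]; lra.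
Qed.

Lemma solution_Tset t j : E (t, j) -> Tset T2 (phi t j).2.
Proof.
move: t j; apply: htd_ind => //; first exact: initial_Tset.
- by move=> a b j ab Ea Eb; exact: Tset_segment.
- move=> t j Et Et1 _; have [_ _ _ _ /(_ t j Et Et1)[_ Gt]] := sol.
  exact: G_cl_Tset Gt.
Qed.

(* The definition of a hybrid time domain admits branching domains; here a zero
   timer at a jump time forbids flowing past it. *)
Lemma no_branching t s i j : E (t, i) -> E (s, j) -> (i < j)%N -> t <= s.
Proof.
move=> Et Es ij; have [r [rs Er Er1]] := htd_jump_before hE Es ij.
apply: le_trans rs; rewrite leNgt; apply/negP => rt.
have [_ _ _ _ /(_ r i Er Er1)[[_ [k k0]] _]] := sol.
have := solution_Tset Et k; rewrite (timer_segment k (ltW rt) Er Et) k0.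
by move=> /andP[? ?]; lra.
Qed.

(* Between jumps the potential [\sum_k tau_k / T1_k] decreases at a constant rate,
   and each jump raises it by at least 1. *)
Lemma jump_count t j : E (t, j) ->
  j%:R <= \sum_k T2 k / T1 k + (\sum_k (T1 k)^-1) * t.
Proof.
pose psi t j := \sum_k (phi t j).2 k 0 / T1 k.
move=> Et; suff H : psi 0 0%N + j%:R <= psi t j + (\sum_k (T1 k)^-1) * t.
  have p0 : 0 <= psi 0 0%N.
    apply: sumr_ge0 => k _; apply: divr_ge0; last exact: ltW.
    by case/andP: (initial_Tset k).
  have pt : psi t j <= \sum_k T2 k / T1 k.
    apply: ler_sum => k _; rewrite ler_pM2r ?invr_gt0//.
    by case/andP: (solution_Tset Et k).
  lra.
move: t j Et; apply: htd_ind => //; first by rewrite mulr0.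
- move=> a b j ab Ea Eb /le_trans; apply.
  rewrite /psi mulr_suml mulr_suml -!big_split /= le_eqVlt; apply/orP; left; apply/eqP.
  by apply: eq_bigr => k _; rewrite (timer_segment k ab Ea Eb); ring.
- move=> t j Et Et1 IH; have [_ _ _ _ /(_ t j Et Et1)[_ [i [[_ i0] _ _ /andP[yi _] yk]]]] := sol.
  have : psi t j + 1 <= psi t j.+1.
    rewrite /psi (bigD1 i)//= [leRHS](bigD1 i)//= i0 mul0r add0r [leLHS]addrC; apply: lerD.
      by rewrite ler_pdivlMr// mul1r.
    by apply: ler_sum => k ki; rewrite yk.
  by rewrite -natr1; lra.
Qed.

End Solution.
End ClosedLoop.

(** * Completeness of maximal solutions *)

Section Stability.
Variables (R : realType) (m q : nat) (ns : 'I_q -> nat).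
Local Notation n := (\sum_(i < q) ns i)%N.
Local Notation state := ('cV[R]_n * 'cV[R]_n * 'cV[R]_q)%type.
Variables (A : 'M[R]_n) (B : 'M[R]_(n, m)) (K : 'M[R]_(m, n))
  (ubar : 'I_m -> R) (T1 T2 : 'I_q -> R)
  (W : 'M[R]_n) (Rb : forall j : 'I_q, 'M[R]_(ns j)) (sigma : 'I_q -> R) (mubar c : R).
Hypothesis ubar_gt0 : forall i, 0 < ubar i.
Hypothesis T1_gt0 : forall i, 0 < T1 i.
Hypothesis T12 : forall i, T1 i <= T2 i.
Hypothesis pW : posdef W.
Hypothesis pR : forall j, posdef (Rb j).
Hypothesis sigma_gt0 : forall j, 0 < sigma j.
Hypothesis mubar_gt0 : 0 < mubar.
Hypothesis c_gt0 : 0 < c.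
Local Notation flow := (flow_cl A B K ubar).
Local Notation C := (@C_cl R q ns T2).
Local Notation D := (@D_cl R q ns T2).
Local Notation G := (@G_cl R q ns T1 T2).
Local Notation V := (lyapunov W Rb sigma).
Hypothesis V_decrease : forall x, Tset T2 x.2 -> V x <= mubar ->
  lyapunov_flow A B K ubar W Rb sigma x <= - (c * V x).

Lemma flow_cl_bounded : exists2 M, 1 <= M &
  forall x, Tset T2 x.2 -> V x <= mubar -> `|flow x| <= M.
Proof.
have [L L0 HL] := xbar_flow_lipschitz A B K ubar_gt0.
have [c1 c10 H1] := sqn_le_lyapunov T2 pW pR sigma_gt0.
(* From [s ^+ 2 <= p] follows [s <= 1 + p], which avoids a square root. *)
pose b := 1 + mubar / c1.
have b1 : 1 <= b by rewrite lerDl divr_ge0// ltW.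
have b0 : 0 <= b by rewrite (le_trans _ b1).
pose z0 := `|xbar_flow A B K ubar 0|.
have z00 : 0 <= z0 by exact: normr_ge0.
have Lb : 0 <= L * b by rewrite mulr_ge0// ltW.
exists (1 + z0 + L * b); first by lra.
move=> x xT xmu.
have sq : sqn (xbar x) <= mubar / c1.
  by rewrite sqn_col_mx ler_pdivlMr// mulrC (le_trans (H1 x xT)).
have zb : `|xbar x| <= b.
  apply: mx_norm_le => // i j; rewrite (ord1 j).
  have h := le_trans (entry_sqn (xbar x) i) sq.
  have h0 := normr_ge0 (xbar x i 0).
  have h2 : `|xbar x i 0| ^+ 2 <= mubar / c1 by rewrite real_normK ?num_real.
  by rewrite /b; set p := mubar / c1 in h2 *; nra.
have fb : `|xbar_flow A B K ubar (xbar x)| <= z0 + L * b.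
  rewrite -[xbar_flow _ _ _ _ _](subrK (xbar_flow A B K ubar 0)) addrC.
  apply: le_trans (ler_normD _ _) _; rewrite lerD2l (le_trans (HL _ _))//.
  by rewrite subr0 ler_pM2l.
apply: state_norm_le; first by lra.
- move=> i; rewrite mxE; apply: le_trans (entry_norm_le _ _ _) (le_trans fb _); lra.
- move=> i; rewrite mxE; apply: le_trans (entry_norm_le _ _ _) (le_trans fb _); lra.
- by move=> k; rewrite !mxE normrN1; lra.
Qed.

Section Solution.
Variables (E : set (R * nat)) (phi : R -> nat -> state).
Hypothesis sol : is_solution C flow D G E phi.

Let hE : hybrid_time_domain E. Proof. by case: sol. Qed.
Let tset t j : E (t, j) -> Tset T2 (phi t j).2.
Proof. exact: (solution_Tset ubar_gt0 T1_gt0 sol). Qed.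

Lemma lyapunov_segment a b j : a <= b -> E (a, j) -> E (b, j) -> V (phi a j) <= mubar ->
  V (phi b j) <= mubar /\ V (phi b j) <= expR (- (c * (b - a))) * V (phi a j).
Proof.
move=> ab Ea Eb Va.
have [c1 c2 c3 d] := flow_segment ubar_gt0 sol ab Ea Eb.
set u := fun s => phi (clip a b s) j in c1 c2 c3 d.
have [vc lc] := lyapunov_continuous A B K W Rb sigma ubar_gt0 c1 c2 c3.
have Wsym : (invmx W)^T = invmx W by have [] := posdef_invmx pW.
have Rsym j' : (Rb j')^T = Rb j' by have [] := pR j'.
have vd t : a < t < b -> is_derive t 1 (fun s => V (u s))
    (lyapunov_flow A B K ubar W Rb sigma (u t)).
  by move=> /d; exact: is_derive_lyapunov.
have uE t : a <= t <= b -> u t = phi t j by move=> tab; rewrite /u clip_id.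
have uT t : Tset T2 (u t).2.
  by apply: tset; apply: (htd_itv hE Ea Eb); exact: clip_itv.
have Vua : V (u a) <= mubar by rewrite uE ?lexx ?ab.
(* On the level [mubar] the derivative is at most [- (c * mubar)], which is negative. *)
have inv : forall t, a <= t <= b -> V (u t) <= mubar.
  apply: (invariant_sublevel ab vc lc vd _ Vua).
  move=> t tab Vt; have := V_decrease (uT t); rewrite Vt lexx => /(_ isT) /le_lt_trans; apply.
  by rewrite oppr_lt0 mulr_gt0.
have Vb := inv b; have {}Vb : V (phi b j) <= mubar by rewrite -uE ?ab ?lexx// Vb// ab lexx.
split=> //.
(* With the integrating factor [expR (c * s)] the differential inequality says that [g] does not
   increase. *)
pose g (s : R) := expR (c * s) * V (u s).
have ed (s : R) : is_derive s 1 (fun s => expR (c * s)) (c * expR (c * s)).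
  have d4 : is_derive s 1 (fun s : R => c * s) c.
    have := is_deriveZ c (is_derive_id s 1); move/is_derive_eq; apply.
    by rewrite /GRing.scale /= mulr1.
  have := @is_derive1_comp _ expR (fun s => c * s) s _ _ (is_derive_expR _) d4.
  by move/is_derive_eq; apply; rewrite mulrC.
have gd t : a < t < b -> is_derive t 1 g (expR (c * t) *
    (c * V (u t) + lyapunov_flow A B K ubar W Rb sigma (u t))).
  move=> /vd dv; have := is_deriveM (ed t) dv; move/is_derive_eq; apply.
  by rewrite /GRing.scale /=; ring.
have gc : continuous g.
  apply: continuous_mulr => // s; exact: is_derive_continuous (ed s).
have : g b - g a <= 0 * (b - a).
  apply: (mean_value_le ab gd gc) => t /andP[a_t tb].
  rewrite pmulr_rle0 ?expR_gt0// -lerBrDl sub0r; apply: V_decrease => //.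
  by apply: inv; rewrite !ltW.
rewrite mul0r subr_le0 /g !uE ?lexx ?ab// => H.
rewrite -(ler_pM2l (expR_gt0 (c * b))) (le_trans H)// mulrA -expRD.
by have -> : c * b + - (c * (b - a)) = c * a by ring.
Qed.

Hypothesis V0 : V (phi 0 0%N) <= mubar.

Lemma lyapunov_decay t j : E (t, j) ->
  V (phi t j) <= mubar /\ V (phi t j) <= expR (- (c * t)) * V (phi 0 0%N).
Proof.
move: t j; apply: htd_ind => //.
- by split=> //; rewrite mulr0 oppr0 expR0 mul1r.
- move=> a b j ab Ea Eb [Va Va']; have [h1 h2] := lyapunov_segment ab Ea Eb Va.
  split=> //; apply: le_trans h2 _.
  apply: le_trans (ler_wpM2l (expR_ge0 _) Va') _.
  rewrite mulrA -expRD.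
  by have -> : - (c * (b - a)) + - (c * a) = - (c * b) by ring.
- move=> t j Et Et1 [Va Va']; have [_ _ _ _ /(_ t j Et Et1)[_ Gt]] := sol.
  have h := lyapunov_jump W sigma pR Gt.
  by split; exact: le_trans h _.
Qed.

(** The constant is independent of the segment; this uniformity yields a limit at the open end of a
    flow interval. *)
Lemma solution_lipschitz : exists2 M, 1 <= M & forall a b j, a <= b -> E (a, j) -> E (b, j) ->
  `|phi b j - phi a j| <= M * (b - a).
Proof.
have [M M1 HM] := flow_cl_bounded; exists M => // a b j ab Ea Eb.
have [/continuous_mxP c1 /continuous_mxP c2 /continuous_mxP c3 d] :=
  flow_segment ubar_gt0 sol ab Ea Eb.
set u := fun s => phi (clip a b s) j in c1 c2 c3 d.
have fM t : `|flow (u t)| <= M.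
  have Et : E (clip a b t, j) by apply: (htd_itv hE Ea Eb); exact: clip_itv.
  by apply: HM; [exact: tset|exact: (lyapunov_decay Et).1].
have ub : u b = phi b j by rewrite /u clip_id// ab lexx.
have ua : u a = phi a j by rewrite /u clip_id// ab lexx.
have fe t := state_entry_norm (flow (u t)).
have M0 : 0 <= M * (b - a) by rewrite mulr_ge0 ?subr_ge0// (le_trans _ M1).
apply: state_norm_le => // i; rewrite !mxE -ub -ua.
- apply: (mean_value_norm_le (df := fun t => (flow (u t)).1.1 i 0)
            (f := fun t => (u t).1.1 i 0)) => //.
    by move=> t /d/is_derive_pairP[/is_derive_pairP[/is_derive_mxP]].
  by move=> t _; have [/(_ i)/le_trans h _ _] := fe t; exact: h.
- apply: (mean_value_norm_le (df := fun t => (flow (u t)).1.2 i 0)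
            (f := fun t => (u t).1.2 i 0)) => //.
    by move=> t /d/is_derive_pairP[/is_derive_pairP[_ /is_derive_mxP]].
  by move=> t _; have [_ /(_ i)/le_trans h _] := fe t; exact: h.
- apply: (mean_value_norm_le (df := fun t => (flow (u t)).2 i 0)
            (f := fun t => (u t).2 i 0)) => //.
    by move=> t /d/is_derive_pairP[_ /is_derive_mxP].
  by move=> t _; have [_ _ /(_ i)/le_trans h] := fe t; exact: h.
Qed.

Section TopLevel.
Variables (J : nat) (T : R).
Hypothesis top : forall t j, E (t, j) -> (j <= J)%N.
Hypothesis leT : forall t, E (t, J) -> t <= T.

Let allT t i : E (T, J) -> E (t, i) -> t <= T.
Proof.
move=> ET Et; have := top Et; rewrite leq_eqVlt => /orP[/eqP iJ|iJ].
  by apply: leT; rewrite -iJ.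
exact: (no_branching ubar_gt0 T1_gt0 sol Et ET).
Qed.

Lemma extend_by_jump k : E (T, J) -> (phi T J).2 k 0 = 0 ->
  exists E' psi, [/\ is_solution C flow D G E' psi, E `<=` E', E <> E' &
    forall t j, E (t, j) -> psi t j = phi t j].
Proof.
move=> ET k0; pose x := phi T J.
(* Any reset value between [T1 k] and [T2 k] would do; the smallest is taken. *)
pose y : state := (x.1.1, hblk k x.1.2, \col_i (if i == k then T1 k else x.2 i 0)).
have Gy : G x y.
  exists k; split=> //=; first by split=> //; exact: tset.
    by rewrite mxE eqxx lexx T12.
  by move=> i ik; rewrite mxE (negbTE ik).
have Dx : D x by split; [exact: tset|exists k].
have s' := solution_jump_extension sol top ET (fun t i => @allT t i ET) Dx Gy.
exists (jump_extension E J T), (fun t j => if j == J.+1 then y else phi t j); split=> //.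
- by move=> p; left.
- move=> EE; have : jump_extension E J T (T, J.+1) by right.
  by rewrite -EE => /top; rewrite ltnn.
- move=> t j Et; case: eqVneq => // jJ; subst j.
  by have := top Et; rewrite ltnn.
Qed.

Lemma extend_by_flow : E (T, J) -> (forall k, 0 < (phi T J).2 k 0) ->
  exists E' psi, [/\ is_solution C flow D G E' psi, E `<=` E', E <> E' &
    forall t j, E (t, j) -> psi t j = phi t j].
Proof.
move=> ET tau0; pose x := phi T J.
have [L L0 HL] := xbar_flow_lipschitz A B K ubar_gt0.
have [d [z [M [d0 z0 zL zd]]]] := picard_lindelof L0 HL (xbar x).
have [e e0 He] := exists_pos_lower_bound tau0.
(* Up to [T + h] the Picard solution is valid and no timer becomes negative. *)
pose h := Num.min (d / 2) e.
have h0 : 0 < h by rewrite lt_min e0 divr_gt0.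
have hd : h <= d / 2 by rewrite ge_min lexx.
have he : h <= e by rewrite ge_min lexx orbT.
pose y t : state := (usubmx (z (t - T)), dsubmx (z (t - T)), x.2 - const_mx (t - T)).
have TT : T <= T + h by rewrite lerDl ltW.
have yT : y T = x.
  rewrite /y subrr z0 /xbar col_mxKu col_mxKd.
  rewrite (_ : const_mx 0 = 0) ?subr0; first by case: (x) => -[].
  by apply/matrixP => i k; rewrite !mxE.
have yphi t : E (t, J) -> T <= t -> y t = phi t J.
  by move=> /leT tT Tt; have -> : t = T by apply/eqP; rewrite eq_le tT.
have yAC : abs_cont_on T (T + h) y.
  apply: (@abs_cont_on_lipschitz _ _ _ _ (`|M| + 1)) => s t Ts st tTh.
  have ts0 : 0 <= t - s by rewrite subr_ge0.
  have zb : `|z (t - T) - z (s - T)| <= (`|M| + 1) * (t - s).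
    apply: le_trans (zL _ _ _) _; first by rewrite lerD2r.
    have -> : t - T - (s - T) = t - s by ring.
    by rewrite ler_wpM2r// (le_trans (ler_norm _))// lerDl.
  apply: state_norm_le; first by rewrite mulr_ge0// addr_ge0.
  - move=> i; rewrite !mxE; apply: le_trans zb.
    by have := entry_norm_le (z (t - T) - z (s - T)) (lshift n i) 0; rewrite !mxE.
  - move=> i; rewrite !mxE; apply: le_trans zb.
    by have := entry_norm_le (z (t - T) - z (s - T)) (rshift n i) 0; rewrite !mxE.
  - move=> k; rewrite !mxE.
    have -> : x.2 k 0 - (t - T) - (x.2 k 0 - (s - T)) = - (t - s) by ring.
    by rewrite normrN ger0_norm// ler_peMl// lerDr.
have yC t : T <= t <= T + h -> C (y t).
  move=> /andP[Tt tTh] k; rewrite !mxE /=; have /andP[_ k2] := tset ET k.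
  by have := He k; rewrite -/x in k2 * => hk; apply/andP; split; lra.
have yd t : T < t < T + h -> is_derive t 1 y (flow (y t)).
  move=> /andP[Tt tTh].
  have zt : col_mx (usubmx (z (t - T))) (dsubmx (z (t - T))) = z (t - T) by exact: vsubmxK.
  have zd' i : is_derive t 1 (fun s => z (s - T) i 0) (xbar_flow A B K ubar (z (t - T)) i 0).
    apply: (@is_derive_translate _ _ (fun s => z s i 0)); apply: zd.
    by apply/andP; split; lra.
  apply/is_derive_pairP; split; [apply/is_derive_pairP; split|]; apply/is_derive_mxP => i k;
    rewrite (ord1 k).
  - rewrite (_ : (fun s => _) = fun s => z (s - T) (lshift n i) 0); last first.
      by apply/funext => s; rewrite mxE.
    by rewrite /flow_cl /= mxE /xbar /= zt; exact: zd'.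
  - rewrite (_ : (fun s => _) = fun s => z (s - T) (rshift n i) 0); last first.
      by apply/funext => s; rewrite mxE.
    by rewrite /flow_cl /= mxE /xbar /= zt; exact: zd'.
  - rewrite (_ : (fun s => _) = fun s => (x.2 i 0 + T) - s); last first.
      by apply/funext => s; rewrite !mxE; ring.
    have := is_deriveB (is_derive_cst (x.2 i 0 + T) t 1) (is_derive_id t 1).
    by move/is_derive_eq; apply; rewrite !mxE sub0r.
have nb t i : E (t, i) -> (i < J)%N -> t <= T by move=> Et _; exact: allT Et.
have ETh t : E (t, J) -> t <= T + h by move=> /leT/le_trans; exact.
have s' := solution_flow_extension sol top nb ET ETh yphi yAC yC (ae_lebesgueW yd).
exists (flow_extension E J T (T + h)); eexists; split; first exact: s'.
- by move=> p; left.
- move=> EE; have : flow_extension E J T (T + h) (T + h, J) by right; rewrite /= TT lexx.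
  by rewrite -EE => /leT; rewrite leNgt ltrDl h0.
- move=> t j Et /=; case: (eqVneq j J) => //= jJ; case: ifPn => // Tt; subst j; exact: yphi.
Qed.

Lemma extend_by_limit t0 : ~ E (T, J) -> E (t0, J) ->
  (forall e, 0 < e -> exists2 t, E (t, J) & T - e < t) ->
  exists E' psi, [/\ is_solution C flow D G E' psi, E `<=` E', E <> E' &
    forall t j, E (t, j) -> psi t j = phi t j].
Proof.
move=> nET Et0 supT; have [M M1 HM] := solution_lipschitz.
have M0 : 0 < M by rewrite (lt_le_trans _ M1).
have ltT t : E (t, J) -> t < T.
  by move=> Et; rewrite lt_neqAle leT// andbT; apply/eqP => tT; apply: nET; rewrite -tT.
have Ein t : t0 <= t < T -> exists2 u, E (u, J) & t < u.
  move=> /andP[_ tT]; have [|u Eu uT] := supT (T - t); first by rewrite subr_gt0.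
  by exists u => //; lra.
have EJ t : t0 <= t < T -> E (t, J).
  move=> tI; have [u Eu tu] := Ein _ tI; apply: (htd_itv hE Et0 Eu).
  by case/andP: tI => -> _ /=; exact: ltW.
have HM' a b : E (a, J) -> E (b, J) -> `|phi b J - phi a J| <= M * `|b - a|.
  move=> Ea Eb; have [ab|/ltW ba] := leP a b.
    by rewrite (ger0_norm (_ : 0 <= b - a)) ?subr_ge0//; exact: HM.
  by rewrite distrC [`|b - a|]distrC (ger0_norm (_ : 0 <= a - b)) ?subr_ge0//; exact: HM.
pose I := {t | E (t, J)}.
(* The intervals of radius [M * (T - t)] around the values of [g] meet pairwise by the Lipschitz
   bound; a common point is the limit at [T]. *)
have lim (g : R -> R) : (forall a b, E (a, J) -> E (b, J) -> `|g b - g a| <= M * `|b - a|) ->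
    exists l, forall t, E (t, J) -> `|l - g t| <= M * (T - t).
  move=> gL; have [|l lP] := @exists_between_families R I (exist _ t0 Et0)
      (fun t => g (sval t) - M * (T - sval t)) (fun t => g (sval t) + M * (T - sval t)).
    move=> [s Es] [t Et] /=; have := gL _ _ Et Es; rewrite ler_norml => /andP[_ h].
    have : M * `|s - t| <= M * (T - s + (T - t)).
      rewrite ler_pM2l// ler_norml; have := ltT _ Es; have := ltT _ Et.
      by move=> ? ?; apply/andP; split; lra.
    lra.
  exists l => t Et; have := lP (exist _ t Et) => /= /andP[? ?].
  by rewrite ler_norml; apply/andP; split; lra.
have e1 i : exists l, forall t, E (t, J) -> `|l - (phi t J).1.1 i 0| <= M * (T - t).
  apply: lim => a b Ea Eb; apply: le_trans (HM' _ _ Ea Eb).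
  by have [/(_ i) + _ _] := state_entry_norm (phi b J - phi a J); rewrite !mxE.
have e2 i : exists l, forall t, E (t, J) -> `|l - (phi t J).1.2 i 0| <= M * (T - t).
  apply: lim => a b Ea Eb; apply: le_trans (HM' _ _ Ea Eb).
  by have [_ /(_ i) + _] := state_entry_norm (phi b J - phi a J); rewrite !mxE.
have e3 i : exists l, forall t, E (t, J) -> `|l - (phi t J).2 i 0| <= M * (T - t).
  apply: lim => a b Ea Eb; apply: le_trans (HM' _ _ Ea Eb).
  by have [_ _ /(_ i)] := state_entry_norm (phi b J - phi a J); rewrite !mxE.
have [l1 L1] := choice e1; have [l2 L2] := choice e2; have [l3 L3] := choice e3.
pose l : state := (\col_i l1 i, \col_i l2 i, \col_i l3 i).
have lP t : E (t, J) -> `|l - phi t J| <= M * (T - t).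
  move=> Et; apply: state_norm_le.
  - by rewrite mulr_ge0 ?subr_ge0 ?leT// ltW.
  - by move=> i; rewrite !mxE; exact: L1.
  - by move=> i; rewrite !mxE; exact: L2.
  - by move=> i; rewrite !mxE; exact: L3.
pose y t := if t < T then phi t J else l.
have yphi t : E (t, J) -> t0 <= t -> y t = phi t J by move=> /ltT tT _; rewrite /y tT.
have yAC : abs_cont_on t0 T y.
  apply: (@abs_cont_on_lipschitz _ _ _ _ M) => s t ts st tT.
  rewrite /y; case: ltP => tT'.
    rewrite (le_lt_trans st tT'); apply: HM => //; apply: EJ.
      by rewrite ts (le_lt_trans st).
    by rewrite (le_trans ts st).
  have tE : t = T by apply/eqP; rewrite eq_le tT.
  case: ltP => sT; last by rewrite subrr normr0 mulr_ge0 ?subr_ge0// ltW.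
  by rewrite tE; apply: lP; apply: EJ; rewrite ts.
have yC t : t0 <= t <= T -> C (y t).
  move=> /andP[tt tT]; rewrite /y; case: ltP => tT'; first by apply: tset; apply: EJ; rewrite tt.
  have ap k e : 0 < e -> exists2 s, E (s, J) & `|l3 k - (phi s J).2 k 0| <= e.
    move=> e0; have [|s Es sT] := supT (e / M); first exact: divr_gt0.
    exists s => //; apply: le_trans (L3 _ _ Es) _.
    by rewrite mulrC -ler_pdivlMr//; lra.
  move=> k; rewrite mxE; apply/andP; split; apply/ler_addgt0Pr => e e0.
    have [s Es] := ap k e e0; rewrite ler_norml => /andP[? ?].
    by have /andP[? _] := tset Es k; lra.
  have [s Es] := ap k e e0; rewrite ler_norml => /andP[? ?].
  by have /andP[_ ?] := tset Es k; lra.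
have yd t : t0 < t < T -> is_derive t 1 y (flow (y t)).
  move=> /andP[tt tT]; have tI : t0 <= t < T by rewrite ltW.
  have [u Eu tu] := Ein _ tI.
  have t0u : t0 <= u by rewrite ltW// (lt_trans tt tu).
  have [_ _ _ /(_ t)] := flow_segment ubar_gt0 sol t0u Et0 Eu.
  rewrite tt tu => /(_ isT).
  have -> : y t = phi (clip t0 u t) J by rewrite /y tT clip_id// !ltW.
  apply: is_derive_oo_near (_ : t0 < t < u) _; first by rewrite tt.
  by move=> s /andP[s1 s2]; rewrite clip_id ?(ltW s1) ?(ltW s2)// /y (lt_trans s2 (ltT _ Eu)).
have nb t i : E (t, i) -> (i < J)%N -> t <= t0.
  by move=> Et; exact: (no_branching ubar_gt0 T1_gt0 sol Et Et0).
have s' := solution_flow_extension sol top nb Et0 leT yphi yAC yC (ae_lebesgueW yd).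
exists (flow_extension E J t0 T); eexists; split; first exact: s'.
- by move=> p; left.
- move=> EE; apply: nET; rewrite EE; right; rewrite /= lexx andbT leT//.
- move=> t j Et /=; case: (eqVneq j J) => //= jJ; case: ifPn => // Tt; subst j; exact: yphi.
Qed.

End TopLevel.
End Solution.

Lemma maximal_complete E phi : maximal_solution C flow D G E phi ->
  V (phi 0 0%N) <= mubar -> complete_dom E.
Proof.
move=> [sol maxi] V0 M; apply: contrapT => /forallNP nM; apply: maxi.
have hE : hybrid_time_domain E by case: sol.
have bnd t j : E (t, j) -> t + j%:R < M.
  by move=> Et; rewrite ltNge; apply/negP => Mt; apply: (nM t); exists j.
have E00 : E (0, 0%N) by have [_ []] := sol.
(* A bound on [t + j] bounds the levels reached, so there is a highest one, [J]; the supremum [T] of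
   its times is where the solution gets extended. *)
pose lev j := `[< exists t, E (t, j) >].
have levb j : lev j -> (j <= Num.bound M)%N.
  move=> /asboolP[t Et]; have t0 := hE.1 _ Et; have h := bnd _ _ Et.
  have M0 : 0 <= M by rewrite ltW// (le_lt_trans _ h)// addr_ge0.
  rewrite ltnW// -(ltr_nat R) (lt_trans _ (archi_boundP M0))// (le_lt_trans _ h)//.
  by rewrite lerDr.
have lev0 : exists j, lev j by exists 0%N; apply/asboolP; exists 0.
case: (ex_maxnP lev0 levb) => J /asboolP[t0 Et0] maxJ.
have top t j : E (t, j) -> (j <= J)%N by move=> Et; apply: maxJ; apply/asboolP; exists t.
pose S := [set t | E (t, J)].
have hS : has_sup S.
  split; first by exists t0.
  by exists M => t Et; rewrite ltW// (le_lt_trans _ (bnd _ _ Et))// lerDl.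
pose T := sup S.
have leT t : E (t, J) -> t <= T by exact: sup_upper_bound.
have [ET|nET] := pselect (E (T, J)); last first.
  apply: (extend_by_limit sol V0 top leT nET Et0) => e e0.
  have [|t Et tT] := @sup_gt _ S (T - e) hS.1; first by rewrite gtrBl.
  by exists t.
have [[k k0]|nk] := pselect (exists k, (phi T J).2 k 0 = 0).
  exact: (extend_by_jump sol top leT ET k0).
apply: (extend_by_flow sol top leT ET) => k.
have /andP[+ _] := solution_Tset ubar_gt0 T1_gt0 sol ET k.
rewrite le_eqVlt => /orP[/eqP k0|//].
by exfalso; apply: nk; exists k.
Qed.

End Stability.

(** * Exponential bound and basin of attraction *)

Unset Implicit Arguments.

Theorem theorem1 (R : realType) (m q : nat) (ns : 'I_q -> nat)
  (A : 'M[R]_(\sum_(i < q) ns i)) (B : 'M[R]_(\sum_(i < q) ns i, m))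
  (K : 'M[R]_(m, \sum_(i < q) ns i))
  (ubar : 'I_m -> R) (T1 T2 : 'I_q -> R)
  (W : 'M[R]_(\sum_(i < q) ns i)) (Rb : forall j : 'I_q, 'M[R]_(ns j))
  (S : 'M[R]_m) (sigma : 'I_q -> R) (mubar : R)
  (Z J : 'M[R]_(m, \sum_(i < q) ns i)) :
  (0 < m)%N -> (0 < q)%N -> (forall i, (0 < ns i)%N) ->
  (forall i, 0 < ubar i) ->
  (forall i, 0 < T1 i /\ T1 i <= T2 i) ->
  posdef W -> (forall j, posdef (Rb j)) -> diagposdef S ->
  (forall j, 0 < sigma j) -> 0 < mubar ->
  (forall i : 'I_m, possemidef (LMI1 W Rb Z J ubar mubar i)) ->
  (forall tau : 'cV[R]_q, Tset T2 tau ->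
     negdef (Mfrak A B K W Rb S sigma Z J tau)) ->
  [/\ exp_stable (C_cl T2) (flow_cl A B K ubar) (D_cl T2) (G_cl T1 T2)
        (distA T2),
      (forall x, Qset T2 W sigma Rb mubar x ->
         in_basin (C_cl T2) (flow_cl A B K ubar) (D_cl T2) (G_cl T1 T2)
           (distA T2) x) &
      exists lambda kappa : R, [/\ 0 < lambda, 0 < kappa &
        forall (E : set (R * nat)) (phi : R -> nat -> _),
          maximal_solution (C_cl T2) (flow_cl A B K ubar) (D_cl T2)
            (G_cl T1 T2) E phi ->
          Qset T2 W sigma Rb mubar (phi 0 0%N) ->
          forall (t : R) (j : nat), E (t, j) ->
            distA T2 (phi t j)
              <= kappa * expR (- lambda * (t + j%:R)) * distA T2 (phi 0 0%N)]].
Proof.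
move=> _ _ _ u0 T12' pW pR dS s0 mu0 lmi1 lmi2.
have T10 i : 0 < T1 i by case: (T12' i).
have T12 i : T1 i <= T2 i by case: (T12' i).
have [c c0 Vdec] := lyapunov_decrease u0 T10 T12 pW pR dS s0 mu0 lmi1 lmi2.
have [c1 c10 Vlow] := sqn_le_lyapunov T2 pW pR s0.
have [c2 c20 Vupp] := lyapunov_le_sqn T2 W pR s0.
pose r := \sum_k (T1 k)^-1; pose b := \sum_k T2 k / T1 k.
have r0 : 0 <= r by apply: sumr_ge0 => k _; rewrite invr_ge0 ltW.
(* The jump count gives [t + j <= (1 + r) * t + b], whence the factor [1 + r]; the factor 2 appears
   because V is comparable to the square of the distance. *)
pose lambda := c / (2 * (1 + r)).
have lambda0 : 0 < lambda by rewrite divr_gt0// mulr_gt0// ltr_wpDr.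
(* The square root compares V with the squared distance at both ends, and [expR (lambda * b)] pays
   for the offset [b] of the jump count. *)
pose kappa := Num.sqrt (c2 / c1) * expR (lambda * b).
have kappa0 : 0 < kappa by rewrite mulr_gt0 ?expR_gt0// sqrtr_gt0 divr_gt0.
have main E phi : maximal_solution (C_cl T2) (flow_cl A B K ubar) (D_cl T2) (G_cl T1 T2) E phi ->
    lyapunov W Rb sigma (phi 0 0%N) <= mubar ->
    complete_dom E /\ forall t j, E (t, j) -> distA T2 (phi t j)
      <= kappa * expR (- lambda * (t + j%:R)) * distA T2 (phi 0 0%N).
  move=> msol V0; split; first exact: (maximal_complete u0 T10 T12 pW pR s0 mu0 c0 Vdec msol V0).
  move=> t j Et; have [sol _] := msol.
  have xT := solution_Tset u0 T10 sol Et; have xT0 := initial_Tset sol.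
  rewrite !distA_C//; set s := sqn _ + sqn _; set s' := sqn _ + sqn _.
  have ss : s <= (kappa * expR (- lambda * (t + j%:R))) ^+ 2 * s'.
    have [_ Vt] := lyapunov_decay u0 T10 pW pR mu0 c0 Vdec sol V0 Et.
    have jc := jump_count u0 T10 sol Et; rewrite -/r -/b in jc.
    have ct : - (c * t) <= (lambda * b + lambda * b)
        + (- lambda * (t + j%:R) + - lambda * (t + j%:R)).
      have -> : c = lambda * (2 * (1 + r)) by rewrite divfK// mulf_neq0// gt_eqF// ltr_wpDr.
      have : lambda * (t + j%:R) <= lambda * ((1 + r) * t + b) by rewrite ler_pM2l//; lra.
      lra.
    have ec : expR (- (c * t)) <= expR (lambda * b) ^+ 2 * expR (- lambda * (t + j%:R)) ^+ 2.
      by rewrite !expr2 -!expRD ler_expR.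
    have k2 : Num.sqrt (c2 / c1) ^+ 2 = c2 / c1 by rewrite sqr_sqrtr// divr_ge0// ltW.
    rewrite /kappa !exprMn k2.
    move: ec; set e1 := expR (lambda * b); set e2 := expR (- lambda * _) => ec.
    rewrite -(ler_pM2l c10) (le_trans (Vlow _ xT))// (le_trans Vt)//.
    have -> : c1 * (c2 / c1 * e1 ^+ 2 * e2 ^+ 2 * s') = (e1 ^+ 2 * e2 ^+ 2) * (c2 * s').
      by field; rewrite gt_eqF.
    apply: ler_pM => //; [exact: lyapunov_ge0|exact: Vupp].
  apply: le_trans (ler_wsqrtr ss) _.
  rewrite sqrtrM ?sqr_ge0// sqrtr_sqr ger0_norm// mulr_ge0 ?expR_ge0// ltW//.
have QV x : Qset T2 W sigma Rb mubar x -> lyapunov W Rb sigma x <= mubar.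
  by move=> [_]; rewrite lyapunovE.
split.
(* Within this distance of the set, [Vupp] gives [V <= mubar]. *)
- pose d := Num.sqrt (mubar / c2).
  exists kappa, lambda, d; split=> //; first by rewrite sqrtr_gt0 divr_gt0.
  move=> E phi msol dd; apply: main => //.
  have xT0 := initial_Tset msol.1; move: dd; rewrite distA_C// => dd.
  apply: le_trans (Vupp _ xT0) _; rewrite -ler_pdivlMl// mulrC.
  by move: dd; rewrite /d ler_sqrt// divr_ge0// ltW.
- move=> x Qx E phi msol phi0; have V0 := QV _ Qx; rewrite -phi0 in V0.
  have [cE bnd] := main _ _ msol V0; split=> // e e0.
  have d0 : 0 <= distA T2 (phi 0 0%N) by rewrite distA_C ?sqrtr_ge0//; exact: initial_Tset msol.1.
  set d := distA _ _ in bnd d0.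
  (* From [1 + s <= expR s] with [s = lambda * (t + j)]: beyond this bound, [kappa * d] is at most
     [e * s]. *)
  exists (kappa * d / (lambda * e)) => t j Et tj; apply: le_trans (bnd _ _ Et) _.
  rewrite mulNr expRN mulrAC ler_pdivrMr ?expR_gt0//.
  have := expR_ge1Dx (lambda * (t + j%:R)).
  have le0 : 0 < lambda * e by exact: mulr_gt0.
  move: tj; rewrite (ler_pdivrMr _ _ le0) => tj h.
  apply: le_trans (_ : _ <= e * (1 + lambda * (t + j%:R))) _; last by rewrite ler_pM2l.
  by lra.
- exists lambda, kappa; split=> // E phi msol /QV V0 t j Et.
  exact: (main _ _ msol V0).2.
Qed.
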